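(* The full opacity decision problem and the weak opacity decision problem are undecidable for timed automata whose action set $\Sigma$ has exactly one action and which have no $\varepsilon$-transitions.
   Context: A timed automaton (TA) is a tuple $\mathcal{A}=(\Sigma,L,\ell_0,L_{priv},L_f,X,I,E)$ where $\Sigma$ is a finite set of actions, $L$ a finite set of locations, $\ell_0\in L$ the initial location, $L_{priv}\subseteq L$ the set of private locations, $L_f\subseteq L$ the set of final locations, $X$ a finite set of clocks, $I$ assigns to each location an invariant, and $E$ is a finite set of edges $(\ell,g,a,R,\ell')$ with $\ell,\ell'\in L$, $a\in\Sigma\cup\{\varepsilon\}$ (where $\varepsilon$ is an unobservable action; edges labelled $\varepsilon$ are $\varepsilon$-transitions), $R\subseteq X$ the set of clocks to reset, and $g$ a guard. Invariants and guards are conjunctions of constraints $x\bowtie d$ with $x\in X$, $d\in\mathbb{Z}$, ${\bowtie}\in\{<,\le,=,\ge,>\}$. A clock valuation is a map $\mu:X\to\mathbb{R}_{\ge0}$; a configuration is a pair $(\ell,\mu)$ with $\mu\models I(\ell)$; the initial configuration is $(\ell_0,\mathbf{0})$. A delay $d\ge0$ leads from $(\ell,\mu)$ to $(\ell,\mu+d)$ provided $\mu+d'\models I(\ell)$ for all $d'\in[0,d]$; an edge $(\ell,g,a,R,\ell')$ leads from $(\ell,\mu)$ to $(\ell',\mu')$ if $\mu\models g$, $\mu'$ is $\mu$ with the clocks of $R$ set to $0$, and $\mu'\models I(\ell')$. A run is a finite sequence $(\ell_0,\mu_0),(d_0,e_0),(\ell_1,\mu_1),\dots,(\ell_n,\mu_n)$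 starting in the initial configuration, where each step is a delay $d_i$ followed by taking edge $e_i$, with $\ell_n\in L_f$ and $\ell_i\notin L_f$ for $i<n$. A timed word is a finite sequence of pairs $(a,t)\in\Sigma\times\mathbb{R}_{\ge0}$ with non-decreasing timestamps. The trace of a run is the timed word consisting, in order, of the pairs $(a_i,\sum_{j\le i}d_j)$ for the edges $e_i$ whose action $a_i$ is not $\varepsilon$. A run is private if it visits some location of $L_{priv}$ and public otherwise; $\mathrm{PrivTr}(\mathcal{A})$ and $\mathrm{PubTr}(\mathcal{A})$ denote the sets of traces of private, resp. public, runs. $\mathcal{A}$ is weakly opaque if $\mathrm{PrivTr}(\mathcal{A})\subseteq\mathrm{PubTr}(\mathcal{A})$ and fully opaque if $\mathrm{PrivTr}(\mathcal{A})=\mathrm{PubTr}(\mathcal{A})$. The weak (resp. full) opacity decision problem asks, given a TA, whether it is weakly (resp. fully) opaque. *)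

(* Defs.v *)
From HB Require Import structures.
From mathcomp Require Import all_boot all_order all_algebra.
From mathcomp Require Import classical_sets reals.
Set Implicit Arguments.
Unset Strict Implicit.
Unset Printing Implicit Defensive.
Import Order.TTheory GRing.Theory Num.Theory.

(** * Mu-recursive functions *)

Inductive murec : nat -> Type :=
| MuZero k : murec k
| MuSucc : murec 1
| MuProj k (i : 'I_k) : murec k
| MuComp m k (f : murec m) (g : 'I_m -> murec k) : murec k
| MuPrec k (f : murec k) (g : murec k.+2) : murec k.+1
| MuMin k (f : murec k.+1) : murec k.

Fixpoint prec_rel k (F : k.-tuple nat -> nat -> Prop)
    (G : k.+2.-tuple nat -> nat -> Prop) (n : nat) (v : k.-tuple nat) (y : nat) :
    Prop :=
  if n is m.+1 then
    exists2 z, prec_rel F G m v z & G [tuple of m :: z :: v] y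
  else F v y.

(* [mueval f v y]: the partial function denoted by [f] is defined at [v], with
   value [y]. *)
Fixpoint mueval k (f : murec k) : k.-tuple nat -> nat -> Prop :=
  match f in murec k return k.-tuple nat -> nat -> Prop with
  | MuZero _ => fun _ y => y = 0
  | MuSucc => fun v y => y = (thead v).+1
  | MuProj _ i => fun v y => y = tnth v i
  | MuComp m _ f g => fun v y =>
      exists2 w : m.-tuple nat,
        forall i, mueval (g i) v (tnth w i) & mueval f w y
  | MuPrec _ f g => fun v y =>
      prec_rel (mueval f) (mueval g) (thead v) [tuple of behead v] y
  | MuMin _ f => fun v y =>
      mueval f [tuple of y :: v] 0 /\
      forall z, z < y -> exists u, mueval f [tuple of z :: v] u.+1
  end.

(* Decidability of the problem "given an instance x in the class C, does P x
   hold?". Nothing is required of the algorithm outside of C. *)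
Definition decidable_on (T : Type) (code : T -> nat) (C P : T -> Prop) : Prop :=
  exists f : murec 1, forall x : T, C x ->
    (P x -> mueval f [tuple code x] 1) /\ (~ P x -> mueval f [tuple code x] 0).

(** * Timed automata *)

Inductive cmp := CLt | CLe | CEq | CGe | CGt.

Definition enc_cmp (c : cmp) : nat :=
  match c with CLt => 0 | CLe => 1 | CEq => 2 | CGe => 3 | CGt => 4 end.

Definition dec_cmp (n : nat) : cmp :=
  match n with 0 => CLt | 1 => CLe | 2 => CEq | 3 => CGe | _ => CGt end.

Lemma enc_cmpK : cancel enc_cmp dec_cmp. Proof. by case. Qed.

HB.instance Definition _ := Equality.copy cmp (can_type enc_cmpK).

(* The conjunction of the constraints [x c d] for [(x, c, d)] in the list;
   the empty list is the constraint "true". *)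
Definition constr (nX : nat) := seq ('I_nX * cmp * int).

Record edge (nS nL nX : nat) := Edge {
  esrc : 'I_nL;
  eguard : constr nX;
  eact : option 'I_nS;  (* [None] is the unobservable action epsilon *)
  ereset : {set 'I_nX};
  etgt : 'I_nL }.

Definition edge_tuple nS nL nX (e : edge nS nL nX) :=
  (esrc e, eguard e, eact e, ereset e, etgt e).

Definition tuple_edge nS nL nX
    (t : 'I_nL * constr nX * option 'I_nS * {set 'I_nX} * 'I_nL) :=
  let: (l, g, a, r, l') := t in Edge l g a r l'.

Lemma edge_tupleK nS nL nX : cancel (@edge_tuple nS nL nX) (@tuple_edge nS nL nX).
Proof. by case. Qed.

HB.instance Definition _ nS nL nX :=
  Equality.copy (edge nS nL nX) (can_type (@edge_tupleK nS nL nX)).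

(* The finite sets of actions, locations and clocks are initial segments of the
   natural numbers, so that automata are finite objects that can be given as
   input to an algorithm; the finite set of edges is given by a list. *)
Record timed_automaton := TimedAutomaton {
  nact : nat;
  nloc : nat;
  nclk : nat;
  ta_init : 'I_nloc;
  ta_priv : {set 'I_nloc};
  ta_final : {set 'I_nloc};
  ta_inv : {ffun 'I_nloc -> constr nclk};
  ta_edges : seq (edge nact nloc nclk) }.

Notation action A := 'I_(nact A).
Notation location A := 'I_(nloc A).
Notation clock A := 'I_(nclk A).
Notation ta_edge A := (edge (nact A) (nloc A) (nclk A)).

Section Semantics.
Local Open Scope ring_scope.
Variable R : realType.

Definition valuation (nX : nat) := {ffun 'I_nX -> R}.

Definition sat_cmp (c : cmp) (x y : R) : bool :=
  match c with
  | CLt => x < y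
  | CLe => x <= y
  | CEq => x == y
  | CGe => x >= y
  | CGt => x > y
  end.

Definition sat nX (mu : valuation nX) (g : constr nX) : bool :=
  all (fun t : 'I_nX * cmp * int => sat_cmp t.1.2 (mu t.1.1) t.2%:~R) g.

Definition delayed nX (mu : valuation nX) (d : R) : valuation nX :=
  [ffun x => mu x + d].

Definition reset nX (mu : valuation nX) (r : {set 'I_nX}) : valuation nX :=
  [ffun x => if x \in r then 0 else mu x].

Variable A : timed_automaton.

Definition state := (location A * valuation (nclk A))%type.

Definition is_config (c : state) : Prop :=
  (forall x, 0 <= c.2 x) /\ sat c.2 (ta_inv A c.1).

Definition init_state : state := (ta_init A, [ffun => 0]).

Definition delay_step (c : state) (d : R) (c' : state) : Prop :=
  [/\ 0 <= d,
      forall d', 0 <= d' <= d -> sat (delayed c.2 d') (ta_inv A c.1) &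
      c' = (c.1, delayed c.2 d)].

Definition edge_step (c : state) (e : ta_edge A) (c' : state) : Prop :=
  [/\ e \in ta_edges A, c.1 = esrc e, sat c.2 (eguard e),
      c' = (etgt e, reset c.2 (ereset e)) &
      sat c'.2 (ta_inv A c'.1)].

Definition step (c : state) (d : R) (e : ta_edge A) (c' : state) : Prop :=
  exists2 c1, delay_step c d c1 & edge_step c1 e c'.

(* The sequence (l_0, mu_0), (d_0, e_0), (l_1, mu_1), ..., (l_n, mu_n) is
   represented by the list of the triples (d_i, e_i, (l_(i+1), mu_(i+1))), its
   first configuration being [init_state]. *)
Definition step_seq := seq (R * ta_edge A * state).

Fixpoint steps_from (c : state) (rho : step_seq) : Prop :=
  if rho is (d, e, c') :: rho' then
    [/\ step c d e c', is_config c' & steps_from c' rho']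
  else True.

(* The locations l_1, ..., l_n; the run also visits l_0. *)
Definition next_locs (rho : step_seq) : seq (location A) :=
  [seq t.2.1 | t <- rho].

Definition is_run (rho : step_seq) : Prop :=
  [/\ is_config init_state,
      steps_from init_state rho,
      last (ta_init A) (next_locs rho) \in ta_final A &
      all [predC ta_final A] (belast (ta_init A) (next_locs rho))].

Definition private_run (rho : step_seq) : bool :=
  has [in ta_priv A] (ta_init A :: next_locs rho).

Definition timed_word := seq (action A * R).

Fixpoint trace_from (t : R) (rho : step_seq) : timed_word :=
  if rho is (d, e, _) :: rho' then
    if eact e is Some a then (a, t + d) :: trace_from (t + d) rho'
    else trace_from (t + d) rho'
  else [::].

Definition trace (rho : step_seq) : timed_word := trace_from 0 rho.

Definition PrivTr : set timed_word :=
  [set w | exists2 rho, is_run rho /\ private_run rho & trace rho = w]%classic.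

Definition PubTr : set timed_word :=
  [set w | exists2 rho, is_run rho /\ ~~ private_run rho & trace rho = w]%classic.

Definition weakly_opaque : Prop := (PrivTr `<=` PubTr)%classic.

Definition fully_opaque : Prop := PrivTr = PubTr.

End Semantics.

Definition one_action (A : timed_automaton) : Prop := nact A = 1.

Definition no_epsilon (A : timed_automaton) : Prop :=
  forall e, e \in ta_edges A -> eact e <> None.

(** * Goedel numbering of timed automata *)

Definition enc_seq (T : Type) (enc : T -> nat) (s : seq T) : nat :=
  CodeSeq.code (map enc s).

Definition enc_int (z : int) : nat :=
  match z with Posz n => n.*2 | Negz n => n.*2.+1 end.

Definition enc_atom nX (t : 'I_nX * cmp * int) : nat :=
  CodeSeq.code [:: t.1.1 : nat; enc_cmp t.1.2; enc_int t.2].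

Definition enc_constr nX (g : constr nX) : nat := enc_seq (@enc_atom nX) g.

Definition enc_act nS (a : option 'I_nS) : nat :=
  if a is Some i then i.+1 else 0.

Definition enc_set n (B : {set 'I_n}) : nat := enc_seq (@nat_of_ord n) (enum B).

Definition enc_edge nS nL nX (e : edge nS nL nX) : nat :=
  CodeSeq.code [:: esrc e : nat; enc_constr (eguard e); enc_act (eact e);
                   enc_set (ereset e); etgt e : nat].

Definition enc_ta (A : timed_automaton) : nat :=
  CodeSeq.code [:: nact A; nloc A; nclk A; ta_init A : nat;
                   enc_set (ta_priv A); enc_set (ta_final A);
                   enc_seq (fun l => enc_constr (ta_inv A l)) (enum 'I_(nloc A));
                   enc_seq (@enc_edge _ _ _) (ta_edges A)].

Lemma code_inj : injective CodeSeq.code.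
Proof. exact: can_inj CodeSeq.codeK. Qed.

Lemma enc_seq_inj T (enc : T -> nat) : injective enc -> injective (enc_seq enc).
Proof. by move=> encI s t /code_inj; apply: inj_map. Qed.

Lemma enc_int_inj : injective enc_int.
Proof.
move=> [m|m] [n|n] /= => [/double_inj->//|||[/double_inj->]//] E.
  by have := congr1 odd E; rewrite /= !odd_double.
by have := congr1 odd E; rewrite /= !odd_double.
Qed.

Lemma enc_atom_inj nX : injective (@enc_atom nX).
Proof.
move=> [[x c] d] [[x' c'] d'] /code_inj [/ord_inj-> Ec Ed].
by rewrite (can_inj enc_cmpK Ec) (enc_int_inj Ed).
Qed.

Lemma enc_constr_inj nX : injective (@enc_constr nX).
Proof. exact: enc_seq_inj (@enc_atom_inj nX). Qed.

Lemma enc_act_inj nS : injective (@enc_act nS).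
Proof. by move=> [a|] [b|] //= [/ord_inj->]. Qed.

Lemma enc_set_inj n : injective (@enc_set n).
Proof.
by move=> B C /(enc_seq_inj (@ord_inj n)) E; apply/setP=> x; rewrite -(mem_enum B) E mem_enum.
Qed.

Lemma enc_edge_inj nS nL nX : injective (@enc_edge nS nL nX).
Proof.
move=> [l g a r l'] [m h b s m'] /code_inj /= [/ord_inj-> Eg Ea Er /ord_inj->].
by rewrite (enc_constr_inj Eg) (enc_act_inj Ea) (enc_set_inj Er).
Qed.

Lemma enc_ta_inj : injective enc_ta.
Proof.
move=> [nS nL nX l0 P F I E] [nS' nL' nX' l0' P' F' I' E'] /code_inj [] /=.
move=> eS eL eX; case: nS' / eS E' => E'.
case: nL' / eL l0' P' F' I' E' => l0' P' F' I' E'.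
case: nX' / eX I' E' => I' E' /ord_inj-> /enc_set_inj-> /enc_set_inj->.
move=> /code_inj/eq_in_map eI /(enc_seq_inj (@enc_edge_inj _ _ _))->.
suff -> : I = I' by [].
by apply/ffunP=> l; apply/enc_constr_inj/eI; rewrite mem_enum.
Qed.

(* Main.v *)
Require Import Defs.
From mathcomp Require Import all_boot all_order all_algebra.
From mathcomp Require Import boolp reals.
From mathcomp Require Import ring lra zify.
Set Implicit Arguments.
Unset Strict Implicit.
Unset Printing Implicit Defensive.
Import Order.TTheory GRing.Theory Num.Theory.

(** The reduction builds automata whose private runs have all nonempty timed words
    as traces, so both notions of opacity say that every nonempty timed word is the
    trace of a public run. Public runs guess a violation in a putative encoding of
    the run of a counter machine: every period of the word describes a
    configuration, the value v of a register being a marker whose position modulo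
    1 is that of the v-th point of a grid which is copied from period to period.
    Apart from two forbidden patterns (a new grid point, and the increment of a
    register at the last grid point), a violation is a pattern of events whose
    prescribed consequence is missing. Hence a word without violation may contain
    superfluous events, but it contains the encoding of the true run, which
    therefore halts since the word is finite; conversely a halting run gives a word
    without violation. So opacity amounts to the divergence of the machine.

    The input n of the machine appears only as the constant of two guards, so the
    code of the automaton is an explicit computable function of n and of a few
    numbers that depend on the program. A decision procedure composed with this
    function is compiled to a counter machine, and the automaton that runs it on
    its own parameters gives a contradiction. *)

(** * Computable functions *)

(** With a single action, events differ only by their dates, so the role of an event is its offset
    in the period. Register values are unbounded while a period has fixed length: they are stored as
    fractional parts, on a grid whose size is chosen by the word. Of the four clocks, [cz] restarts
    with each period, [cw] measures the time since the first event, and [cx], [cy] serve the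
    violation being guessed. The absence of a consequence can be guessed because it is checked by
    loops that exclude one exact value of a clock. This is why the grid must not grow. An increment
    at the last grid point has no event to ask for; were it not forbidden, a short word could be
    free of violations although the machine diverges. Since the input of the diagonal run contains
    the numbers that describe the automaton, no algorithm has to read a program: the compiler is
    never shown to be computable, and no recursion theorem is used. *)

Definition computable (h : nat -> nat) : Prop :=
  exists m : murec 1, forall n, mueval m [tuple n] (h n).

Definition computable2 (h : nat -> nat -> nat) : Prop :=
  exists m : murec 2, forall a b, mueval m [tuple a; b] (h a b).

Lemma computable_id : computable id.
Proof. by exists (MuProj ord0) => n. Qed.

Lemma computable_ext (h h' : nat -> nat) : h =1 h' -> computable h -> computable h'.
Proof. by move=> E [m mP]; exists m => n; rewrite -E. Qed.

Lemma computable_mueval_comp (f : murec 1) h : computable h ->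
  exists m : murec 1, forall n y, mueval f [tuple h n] y -> mueval m [tuple n] y.
Proof.
case=> m mP; exists (MuComp f (fun _ => m)) => n y fy.
by exists [tuple h n] => // i; rewrite fintype.ord1; apply: mP.
Qed.

Lemma computable_comp h h' : computable h -> computable h' -> computable (h \o h').
Proof.
by case=> f fP /(computable_mueval_comp f)[m mP]; exists m => n; apply/mP/fP.
Qed.

Lemma computable_succ h : computable h -> computable (fun n => (h n).+1).
Proof. by move=> ch; apply: (@computable_comp succn) => //; exists MuSucc. Qed.

Lemma computable_const c : computable (fun=> c).
Proof.
elim: c => [|c IH]; first by exists (MuZero 1).
exact: (computable_succ IH).
Qed.

Lemma ord2_cases (i : 'I_2) : i = ord0 \/ i = ord_max.
Proof. by case: i => [[|[|i]] lt_i2] //; [left|right]; apply/val_inj. Qed.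

Lemma computable2_comp h h1 h2 : computable2 h -> computable h1 -> computable h2 ->
  computable (fun n => h (h1 n) (h2 n)).
Proof.
case=> m mP [m1 m1P] [m2 m2P].
exists (MuComp m (fun i : 'I_2 => if i == ord0 then m1 else m2)) => n.
exists [tuple h1 n; h2 n] => // i.
by case: (ord2_cases i) => ->; [apply: m1P|apply: m2P].
Qed.

Lemma computable2_iter h0 h : computable h0 -> computable2 h ->
  computable2 (fun n a => iter n (h a) (h0 a)).
Proof.
case=> m0 m0P [m mP].
pose p i := @MuProj 3 (inord i).
exists (MuPrec m0 (MuComp m (fun i : 'I_2 => if i == ord0 then p 2 else p 1))).
move=> n a /=.
rewrite [thead _]/= /thead !(tnth_nth 0) /=.
have -> : [tuple of behead [tuple n; a]] = [tuple a] by apply/val_inj.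
elim: n => [|n IH] //=; exists (iter n (h a) (h0 a)) => //.
exists [tuple a; iter n (h a) (h0 a)] => // i.
by case: (ord2_cases i) => ->; rewrite /= !(tnth_nth 0) /= inordK.
Qed.

Lemma computable2_swap h : computable2 h -> computable2 (fun a b => h b a).
Proof.
case=> m mP.
exists (MuComp m (fun i : 'I_2 => if i == ord0 then MuProj (inord 1) else MuProj ord0)).
move=> a b; exists [tuple b; a] => // i.
by case: (ord2_cases i) => ->; rewrite /= !(tnth_nth 0) /= ?inordK.
Qed.

Lemma computable2_fst h : computable h -> computable2 (fun a _ => h a).
Proof.
case=> m mP; exists (MuComp m (fun _ => MuProj ord0)) => a b.
by exists [tuple a] => // i; rewrite fintype.ord1.
Qed.

Lemma computable2_snd h : computable h -> computable2 (fun _ a => h a).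
Proof. by move=> /computable2_fst/computable2_swap. Qed.

Lemma computable2_ext h h' : (forall a b, h a b = h' a b) -> computable2 h -> computable2 h'.
Proof. by move=> E [m mP]; exists m => a b; rewrite -E. Qed.

Lemma computable2_add : computable2 addn.
Proof.
apply: computable2_ext (computable2_iter computable_id
  (computable2_snd (computable_succ computable_id))).
by move=> a b /=; elim: a => //= a ->.
Qed.

Lemma computable2_mul : computable2 muln.
Proof.
apply: computable2_ext (computable2_iter (computable_const 0) computable2_add).
by move=> a b /=; elim: a => //= a ->; rewrite mulSn.
Qed.

Lemma computable_pow2 : computable (expn 2).
Proof.
have c2 : computable (fun n => 2 * n).
  exact: computable2_comp computable2_mul (computable_const 2) computable_id.
have := computable2_iter (computable_const 1) (computable2_snd c2).
move=> /computable2_comp /(_ computable_id (computable_const 0)).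
by apply: computable_ext => n /=; elim: n => //= n ->; rewrite expnS.
Qed.

Lemma computable_pred : computable predn.
Proof.
pose p i := @MuProj 2 (inord i).
exists (MuComp (MuPrec (MuZero 0) (p 0)) (fun _ : 'I_1 => MuProj ord0)) => n.
exists [tuple n] => [i|]; first by rewrite fintype.ord1.
rewrite /= /thead !(tnth_nth 0) /=.
suff: prec_rel (mueval (MuZero 0)) (mueval (p 0)) n [tuple] n.-1.
  by congr prec_rel; apply/val_inj.
elim: n => [|n IH] //=; exists n.-1 => //.
by rewrite !(tnth_nth 0) /= inordK.
Qed.

Lemma computable2_sub : computable2 subn.
Proof.
have := computable2_iter computable_id (computable2_snd computable_pred).
move=> /computable2_swap; apply: computable2_ext => a b.
by elim: b => [|b /= ->]; rewrite ?subn0 ?subnS.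
Qed.

Lemma computable_min h : computable2 h -> (forall n, exists y, h y n == 0) ->
  exists2 m, computable m & forall n, h (m n) n = 0 /\ forall z, z < m n -> h z n != 0.
Proof.
case=> f fP ex0; exists (fun n => ex_minn (ex0 n)); last first.
  move=> n; case: ex_minnP => y /eqP y0 ymin; split=> // z.
  by rewrite ltnNge; apply: contra => /ymin.
exists (MuMin f) => n; case: ex_minnP => y /eqP y0 ymin.
split=> [|z ltzy]; first by move: (fP y n); rewrite y0; congr mueval; apply/val_inj.
exists (h z n).-1; have : h z n != 0 by apply: contraL ltzy => /ymin; rewrite -leqNgt.
rewrite -lt0n => /prednK ->.
by move: (fP z n); congr mueval; apply/val_inj.
Qed.

(** As [a] is at most [2 * (a + b)], the integer square root of the code is [a + b], so one
    minimisation suffices to decode. *)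
Definition pair_code a b := (a + b) ^ 2 + a.

Lemma pair_decode : exists p1 p2, [/\ computable p1, computable p2,
  forall a b, p1 (pair_code a b) = a & forall a b, p2 (pair_code a b) = b].
Proof.
have cmul h1 h2 := @computable2_comp _ h1 h2 computable2_mul.
have csub h1 h2 := @computable2_comp _ h1 h2 computable2_sub.
(* This difference vanishes exactly when [n < s.+1 * s.+1], so its least zero in [s] is the integer
   square root of [n]. *)
have c2 : computable2 (fun s n => n.+1 - s.+1 * s.+1).
  have cS := computable_succ computable_id.
  have [m mP] := computable2_sub; have [sq sqP] := cmul _ _ cS cS.
  exists (MuComp m (fun i : 'I_2 => if i == ord0 then MuComp MuSucc (fun _ => MuProj ord_max)
     else MuComp sq (fun _ => MuProj ord0))) => s n.
  exists [tuple n.+1; s.+1 * s.+1] => // i.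
  by case: (ord2_cases i) => ->; [exists [tuple n]|exists [tuple s]] => // j; rewrite fintype.ord1.
have [|sqrt cs sP] := computable_min c2.
  by move=> n; exists n; rewrite subn_eq0 leq_pmulr.
have sK a b : sqrt (pair_code a b) = a + b.
  have [] := sP (pair_code a b); rewrite /pair_code; move: (sqrt _) => s.
  move=> s0 /(_ (a + b)) smin; apply/eqP; rewrite eqn_leq; apply/andP; split.
    by rewrite leqNgt; apply/negP => /smin; rewrite -[_ ^ 2]/(_ * _); nia.
  by move: s0; rewrite -[_ ^ 2]/(_ * _); nia.
have c1 : computable (fun n => n - sqrt n * sqrt n) by exact: csub _ _ computable_id (cmul _ _ cs cs).
exists (fun n => n - sqrt n * sqrt n), (fun n => sqrt n - (n - sqrt n * sqrt n)).
split=> //; first exact: csub _ _ cs c1.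
  by move=> a b; rewrite sK /pair_code -[_ ^ 2]/(_ * _) addKn.
by move=> a b; rewrite sK /pair_code -[_ ^ 2]/(_ * _) !addKn.
Qed.

(** * While programs *)

Definition store := nat -> nat.

Definition upd (s : store) (r v : nat) : store := fun x => if x == r then v else s x.

Lemma upd_id s r v : s r = v -> upd s r v = s.
Proof. by move=> E; apply/funext => x; rewrite /upd; case: eqP => // ->. Qed.

Inductive com :=
| Skip
| Inc of nat
| Dec of nat
| Seq of com & com
| While of nat & com.

Inductive exec : com -> store -> store -> Prop :=
| ExecSkip s : exec Skip s s
| ExecInc r s : exec (Inc r) s (upd s r (s r).+1)
| ExecDec r s : exec (Dec r) s (upd s r (s r).-1)
| ExecSeq c d s s' s'' : exec c s s' -> exec d s' s'' -> exec (Seq c d) s s''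
| ExecWhile0 r c s : s r = 0 -> exec (While r c) s s
| ExecWhileS r c s s' s'' : s r <> 0 -> exec c s s' -> exec (While r c) s' s'' ->
    exec (While r c) s s''.

Definition seqs : seq com -> com := foldr Seq Skip.

Definition clear r := While r (Dec r).

Definition move_reg r o := While r (seqs [:: Dec r; Inc o]).

(** Reading [r] empties it; [t] collects a second copy, from which [r] is restored. *)
Definition copy_reg r o t :=
  Seq (While r (seqs [:: Dec r; Inc o; Inc t])) (move_reg t r).

Ltac upd_solve := apply/funext => ?; rewrite /upd;
  repeat (case: eqP; try move=> ?; subst); try lia.

Lemma exec_eq c s s1 s2 : exec c s s1 -> s1 = s2 -> exec c s s2.
Proof. by move=> H <-. Qed.

Lemma exec_clear r s : exec (clear r) s (upd s r 0).
Proof.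
elim: {s}(s r) {-2}s (erefl (s r)) => [|n IH] s E.
  by rewrite upd_id //; apply: ExecWhile0.
apply: ExecWhileS (ExecDec r s) _; first by rewrite E.
by apply: exec_eq (IH _ _) _; [rewrite /upd eqxx E|upd_solve].
Qed.

Lemma exec_move r o s : r != o ->
  exec (move_reg r o) s (upd (upd s o (s o + s r)) r 0).
Proof.
move=> /eqP ro; elim: {s}(s r) {-2}s (erefl (s r)) => [|n IH] s E.
  apply: exec_eq (ExecWhile0 _ E) _.
  by rewrite ?E addn0 [upd s o _]upd_id // upd_id.
apply: ExecWhileS.
- by rewrite E.
- exact: ExecSeq (ExecDec _ _) (ExecSeq (ExecInc _ _) (ExecSkip _)).
apply: exec_eq (IH _ _) _.
  by rewrite /upd eqxx; case: eqP => //; lia.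
by upd_solve.
Qed.

Lemma exec_copy r o t s : r != o -> r != t -> o != t -> s o = 0 -> s t = 0 ->
  exec (copy_reg r o t) s (upd s o (s r)).
Proof.
move=> /eqP ro /eqP rt /eqP ot o0 t0.
have loop s1 : exec (While r (seqs [:: Dec r; Inc o; Inc t])) s1
    (upd (upd (upd s1 o (s1 o + s1 r)) t (s1 t + s1 r)) r 0).
  elim: {s1}(s1 r) {-2}s1 (erefl (s1 r)) => [|n IH] s1 E.
    apply: exec_eq (ExecWhile0 _ E) _.
    by rewrite ?E !addn0 [upd s1 o _]upd_id // [upd s1 t _]upd_id // upd_id.
  apply: ExecWhileS.
  - by rewrite E.
  - exact: ExecSeq (ExecDec _ _) (ExecSeq (ExecInc _ _) (ExecSeq (ExecInc _ _) (ExecSkip _))).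
  apply: exec_eq (IH _ _) _.
    by rewrite /upd eqxx; repeat case: eqP => //; lia.
  by upd_solve.
apply: ExecSeq (loop s) _.
apply: exec_eq (exec_move _ _) _; first by apply/eqP => /esym.
by upd_solve.
Qed.

(* [compile f args o b] stores in [o] the value of [f] at the contents of the
   registers [args]; registers from [b] on are scratch space, zero before and
   after the execution. *)
Fixpoint compile k (f : murec k) (args : seq nat) (o b : nat) : com :=
  match f with
  | MuZero _ => Skip
  | MuSucc => Seq (copy_reg (nth 0 args 0) o b) (Inc o)
  | MuProj _ i => copy_reg (nth 0 args i) o b
  | MuComp m _ f g =>
      seqs [:: seqs [seq compile (g i) args (b + i) (b + m) | i <- enum 'I_m];
               compile f (iota b m) o (b + m);
               seqs [seq clear r | r <- iota b m]]
  | MuPrec _ f g =>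
      seqs [:: copy_reg (nth 0 args 0) (b + 3) b;
               compile f (behead args) b.+1 (b + 4);
               While (b + 3) (seqs [:: Dec (b + 3);
                 compile g (b :: b.+1 :: behead args) b.+2 (b + 4);
                 clear b.+1; move_reg b.+2 b.+1; Inc b]);
               clear b;
               move_reg b.+1 o]
  | MuMin _ f =>
      seqs [:: compile f (b :: args) b.+1 b.+2;
               While b.+1 (seqs [:: clear b.+1; Inc b;
                 compile f (b :: args) b.+1 b.+2]);
               move_reg b o]
  end.

Definition compile_spec k (f : murec k) := forall args o b s (v : k.-tuple nat) y,
  [seq s a | a <- args] = v -> mueval f v y ->
  all (ltn^~ b) args -> o < b -> o \notin args -> s o = 0 ->
  (forall x, b <= x -> s x = 0) -> exec (compile f args o b) s (upd s o y).

Lemma map_upd s args r v : r \notin args -> [seq upd s r v a | a <- args] = map s args.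
Proof. by move=> ra; apply/eq_in_map => x xa; rewrite /upd; case: eqP => // E; rewrite -E xa in ra. Qed.

Lemma compileP k (f : murec k) : compile_spec f.
Proof.
elim: f => {k}.
- move=> k args o b s v y _ /= -> _ _ _ o0 _.
  by rewrite upd_id //; apply: ExecSkip.
- move=> args o b s v y Ev /= -> alt ltob oa o0 b0.
  have sza : size args = 1 by rewrite -(size_map s) Ev size_tuple.
  case: args sza Ev alt oa => [|a [|]] //= _ Ev alt oa.
  move: alt oa; rewrite inE andbT => ltab oa.
  have bb := b0 _ (leqnn b).
  apply: ExecSeq (exec_copy _ _ _ _ _) _ => //=; try lia.
  apply: exec_eq (ExecInc _ _) _.
  by rewrite /thead (tnth_nth 0) -Ev /=; upd_solve.
- move=> k i args o b s v y Ev /= -> alt ltob oa o0 b0.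
  have sza : size args = k by rewrite -(size_map s) Ev size_tuple.
  have ia : nth 0 args i \in args by rewrite mem_nth // sza.
  have ltab := allP alt _ ia.
  have bb := b0 _ (leqnn b).
  apply: exec_eq (exec_copy _ _ _ _ _) _ => //.
  + by apply: contraNneq oa => <-.
  + by move: ltab => /=; lia.
  + by lia.
  by rewrite (tnth_nth 0) -Ev (nth_map 0) // sza.
- move=> m k f IHf g IHg args o b s v y Ev /= [w gw fw] alt ltob oa o0 b0.
  pose st (l : seq nat) := fun x => if (b <= x) && (x - b \in l) then nth 0 w (x - b) else s x.
  have loop l l0 : uniq [seq val i | i <- l0 ++ l] ->
      exec (seqs [seq compile (g i) args (b + i) (b + m) | i <- l])
        (st (map val l0)) (st (map val (l0 ++ l))).
    elim: l l0 => [|i l IH] l0 ul /=; first by rewrite cats0; apply: ExecSkip.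
    have /= il0 : val i \notin map val l0.
      by move: ul; rewrite map_cat cat_uniq /= => /and3P[_ /norP[]].
    rewrite -cat_rcons; apply: ExecSeq (IH _ _); last by rewrite cat_rcons.
    apply: exec_eq (IHg i _ _ _ _ _ _ _ (gw i) _ _ _ _ _) _.
    + rewrite -Ev; apply/eq_in_map => a aa; rewrite /st; case: leqP => // leba.
      by move: (allP alt _ aa) => /=; lia.
    + by apply/allP => a /(allP alt) /=; lia.
    + by have := ltn_ord i; lia.
    + by apply/negP => /(allP alt) /=; lia.
    + by rewrite /st leq_addr addKn (negPf il0) b0 ?leq_addr.
    + move=> x lex; rewrite /st ifF ?b0 //; first by lia.
      apply/negP => /andP[_ /mapP[j _ E]]; have := ltn_ord j; rewrite -E; lia.
    apply/funext => x; rewrite /upd /st map_rcons mem_rcons inE.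
    case: eqP => [->|ne]; first by rewrite leq_addr addKn eqxx (tnth_nth 0).
    by case: (leqP b x) => //= lebx; rewrite (_ : (x - b == i) = false) //; lia.
  have -> : s = st [::] by apply/funext => x; rewrite /st andbF.
  apply: ExecSeq (loop _ [::] _) _; first by rewrite val_enum_ord iota_uniq.
  rewrite cat0s val_enum_ord.
  have stb j : j < m -> st (iota 0 m) (b + j) = nth 0 w j.
    by move=> ltjm; rewrite /st leq_addr addKn mem_iota ltjm.
  apply: ExecSeq.
    apply: IHf fw _ _ _ _ _.
    + apply: (@eq_from_nth _ 0); first by rewrite size_map size_iota size_tuple.
      by move=> j; rewrite size_map size_iota => lj; rewrite (nth_map 0) ?size_iota ?nth_iota ?stb.
    + by apply/allP => x; rewrite mem_iota => /andP[].
    + by lia.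
    + by rewrite mem_iota leqNgt ltob.
    + by rewrite /st leqNgt ltob.
    + by move=> x lex; rewrite /st mem_iota ifF ?b0 //; lia.
  have clr l s1 : exec (seqs [seq clear r | r <- l]) s1 (fun x => if x \in l then 0 else s1 x).
    elim: l s1 => [|r l IH] s1 /=.
      by apply: exec_eq (ExecSkip _) _; apply/funext.
    apply: ExecSeq (exec_clear _ _) _; apply: exec_eq (IH _) _.
    by apply/funext => x; rewrite inE /upd; case: eqP => //=; case: ifP.
  apply: ExecSeq (clr _ _) _; apply: exec_eq (ExecSkip _) _.
  apply/funext => x; rewrite mem_iota /upd /st mem_iota andbF.
  case: (ltnP x b) => /= lexb; first by [].
  have -> : (x == o) = false by lia.
  case: ltnP => lexb' /=; first by rewrite b0.
  by rewrite ifF //; lia.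
- move=> k f IHf g IHg args o b s v y Ev /= Hy alt ltob oa o0 b0.
  have sza : size args = k.+1 by rewrite -(size_map s) Ev size_tuple.
  case: args sza Ev alt oa => [|a args] //= [sza] Ev /andP[ltab alt].
  rewrite inE => /norP[oa oargs].
  have Etl : [seq s a | a <- args] = [tuple of behead v] by rewrite /= -Ev.
  have Ehd : thead v = s a by rewrite /thead (tnth_nth 0) -Ev.
  rewrite {}Ehd in Hy; move: {v Ev}[tuple of behead v] Hy Etl => v Hy Ev.
  have notin r : b <= r -> r \notin args.
    by move=> ler; apply/negP => /(allP alt) /=; lia.
  apply: ExecSeq.
    by apply: exec_copy => /=; try lia; apply: b0; lia.
  (* The store at the head of the recursion loop: [m] steps done, current value [z], [l] steps
     left. *)
  pose st m z l := upd (upd (upd s (b + 3) l) b.+1 z) b m.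
  (* Induction on the steps left: the values are extracted downwards from the final [y], and the
     loop is then run upwards on these same values. *)
  have prefix l m : prec_rel (mueval f) (mueval g) (l + m) v y ->
     exists2 z, prec_rel (mueval f) (mueval g) m v z &
     exec (While (b + 3) (seqs [:: Dec (b + 3);
                 compile g (b :: b.+1 :: args) b.+2 (b + 4);
                 clear b.+1; move_reg b.+2 b.+1; Inc b])) (st m z l) (st (l + m) y 0).
    elim: l m => [|l IH] m Hm.
      by exists y => //; apply: ExecWhile0; rewrite /st /upd; repeat case: eqP => //; lia.
    rewrite addSnnS in Hm; have [z' /= [z Hz gz'] E] := IH _ Hm; exists z => //.
    apply: ExecWhileS; last by rewrite addSnnS; exact: E.
      by rewrite /st /upd; repeat case: eqP => //; lia.
    apply: ExecSeq (ExecDec _ _) _; apply: ExecSeq.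
      apply: IHg gz' _ _ _ _ _.
      + rewrite /= -Ev; congr [:: _, _ & _]; last (apply/eq_in_map => x /(allP alt) /= ltx);
          by rewrite /st /upd; repeat case: eqP => //; lia.
      + rewrite /=; apply/and3P; split; [by lia | by lia |].
        by apply/allP => x /(allP alt) /=; lia.
      + by lia.
      + by rewrite !inE !negb_or notin; lia.
      + by rewrite /st /upd; repeat case: eqP => //=; try lia; move=> *; apply: b0; lia.
      + by move=> x lex; rewrite /st /upd; repeat case: eqP => //=; try lia; move=> *; apply: b0; lia.
    apply: ExecSeq (exec_clear _ _) _; apply: ExecSeq (exec_move _ _) _; first by lia.
    apply: ExecSeq (ExecInc _ _) _; apply: exec_eq (ExecSkip _) _.
    have b2 : s b.+2 = 0 by apply: b0; lia.
    by rewrite /st; upd_solve.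
  have [|z /= fz E] := prefix (s a) 0; first by rewrite addn0.
  apply: ExecSeq.
    apply: IHf fz _ _ _ _ _.
    + by rewrite map_upd ?notin ?leq_addr.
    + by apply/allP => x /(allP alt) /=; lia.
    + by lia.
    + by apply: notin; lia.
    + by rewrite /upd ifF ?b0 //; lia.
    + by move=> x lex; rewrite /upd ifF ?b0 //; lia.
  rewrite addn0 in E; have b00 : s b = 0 by apply: b0; lia.
  rewrite /st [upd (upd _ _ z) b 0]upd_id in E; last by rewrite /upd; repeat case: eqP => //; lia.
  apply: ExecSeq; first exact: E.
  apply: ExecSeq (exec_clear _ _) _; apply: ExecSeq (exec_move _ _) _; first by lia.
  apply: exec_eq (ExecSkip _) _.
  have b1 : s b.+1 = 0 by apply: b0; lia.
  have b3 : s (b + 3) = 0 by apply: b0; lia.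
  by rewrite /st; upd_solve.
- move=> k f IHf args o b s v y Ev /= [fy fz] alt ltob oa o0 b0.
  have notin r : b <= r -> r \notin args.
    by move=> ler; apply/negP => /(allP alt) /=; lia.
  have call z u : mueval f [tuple of z :: v] u ->
      exec (compile f (b :: args) b.+1 b.+2) (upd s b z) (upd (upd s b z) b.+1 u).
    move=> fu; apply: IHf fu _ _ _ _ _.
    + by rewrite /= map_upd ?notin // Ev /upd eqxx.
    + by rewrite /=; apply/andP; split; [lia|apply/allP => x /(allP alt) /=; lia].
    + by lia.
    + by rewrite inE negb_or notin; lia.
    + by rewrite /upd ifF ?b0 //; lia.
    + by move=> x lex; rewrite /upd ifF ?b0 //; lia.
  have loop l z : z + l = y -> exists2 u, mueval f [tuple of z :: v] u &
      exec (While b.+1 (seqs [:: clear b.+1; Inc b; compile f (b :: args) b.+1 b.+2]))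
        (upd (upd s b z) b.+1 u) (upd s b y).
    have b1 : s b.+1 = 0 by apply: b0; lia.
    elim: l z => [|l IH] z Ezl.
      rewrite addn0 in Ezl; rewrite Ezl; exists 0 => //.
      apply: exec_eq (ExecWhile0 _ _) _; first by rewrite /upd eqxx.
      by upd_solve.
    have [|u' fu' E] := IH z.+1; first by rewrite -Ezl addSnnS.
    have [|u fu] := fz z; first by lia.
    exists u.+1 => //; apply: ExecWhileS E; first by rewrite /upd eqxx.
    apply: ExecSeq (exec_clear _ _) _; apply: ExecSeq (ExecInc _ _) _.
    set s1 := upd _ b _; have -> : s1 = upd s b z.+1 by rewrite /s1; upd_solve.
    exact: ExecSeq (call _ _ fu') (ExecSkip _).
  have [u fu E] := loop y 0 (erefl _).
  have b00 : s b = 0 by apply: b0.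
  apply: ExecSeq; first by have := call _ _ fu; rewrite [upd s b 0]upd_id //; exact.
  apply: ExecSeq; first by move: E; rewrite [upd s b 0]upd_id //; exact.
  apply: ExecSeq (exec_move _ _) _; first by lia.
  by apply: exec_eq (ExecSkip _) _; upd_solve.
Qed.

(** * Counter machines *)

Inductive op := OpNop | OpInc | OpDec.

Definition apply_op (o : op) (c : nat) : nat :=
  match o with OpNop => c | OpInc => c.+1 | OpDec => c.-1 end.

Record instr := Instr { ireg : nat; iop : op; ijz : nat; ijn : nat }.

Definition istep (i : instr) (s : store) : nat * store :=
  (if s (ireg i) == 0 then ijz i else ijn i,
   upd s (ireg i) (apply_op (iop i) (s (ireg i)))).

Definition nop_instr := Instr 0 OpNop 0 0.

(* The instructions of [prog] are numbered from 1. State 0 loads the input [n]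
   into register 0: it increments that register during the first [n] steps. *)
Definition mstep (n : nat) (prog : seq instr) (k : nat) (c : nat * store) : nat * store :=
  if c.1 is q.+1 then
    if q < size prog then istep (nth nop_instr prog q) c.2 else c
  else istep (if k < n then Instr 0 OpInc 0 0 else Instr 0 OpNop 1 1) c.2.

Fixpoint cfg (n : nat) (prog : seq instr) (k : nat) : nat * store :=
  if k is k'.+1 then mstep n prog k' (cfg n prog k') else (0, fun=> 0).

Definition halts n prog := exists k, size prog < (cfg n prog k).1.

Fixpoint flat (p : nat) (c : com) : seq instr :=
  match c with
  | Skip => [::]
  | Inc r => [:: Instr r OpInc p.+1 p.+1]
  | Dec r => [:: Instr r OpDec p.+1 p.+1]
  | Seq c d => flat p c ++ flat (p + size (flat p c)) d
  | While r c =>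
      let body := flat p.+1 c in
      Instr r OpNop (p + size body).+2 p.+1 :: rcons body (Instr 0 OpNop p p)
  end.

Definition code_at (prog : seq instr) (p : nat) (l : seq instr) :=
  exists2 a, size a = p & exists b, prog = a ++ l ++ b.

Lemma code_at_cat prog p l l' : code_at prog p (l ++ l') ->
  code_at prog p l /\ code_at prog (p + size l) l'.
Proof.
case=> a Ea [b ->]; split; first by exists a => //; exists (l' ++ b); rewrite !catA.
by exists (a ++ l); [rewrite size_cat Ea|exists b; rewrite !catA].
Qed.

Lemma code_at_head prog p i l : code_at prog p (i :: l) ->
  p < size prog /\ nth nop_instr prog p = i.
Proof.
case=> a Ea [b ->]; rewrite !size_cat /= nth_cat Ea ltnn subnn; split=> //.
by lia.
Qed.

Lemma cfg_instr n prog k p i l s : code_at prog p (i :: l) -> cfg n prog k = (p.+1, s) ->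
  cfg n prog k.+1 = istep i s.
Proof. by move=> /code_at_head[lt_p Ei] /= ->; rewrite /mstep /= lt_p Ei. Qed.

(** Position [p] of the program carries the label [p.+1], because state 0 is reserved for loading
    the input; hence the shift. *)
Lemma flat_exec n prog c s s' p k : exec c s s' -> code_at prog p (flat p.+1 c) ->
  cfg n prog k = (p.+1, s) ->
  exists k', cfg n prog k' = (p.+1 + size (flat p.+1 c), s').
Proof.
move=> E; elim: E p k => {c s s'}.
- by move=> s p k _ H; exists k; rewrite addn0.
- by move=> r s p k /cfg_instr H /H E; exists k.+1; rewrite E /istep /= if_same addn1.
- by move=> r s p k /cfg_instr H /H E; exists k.+1; rewrite E /istep /= if_same addn1.
- move=> c d s s' s'' _ IHc _ IHd p k /= /code_at_cat[Hc Hd] /(IHc _ _ Hc)[k' /(IHd _ _ Hd)[k'' E]].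
  by exists k''; rewrite E size_cat addnA.
- move=> r c s r0 p k /= /cfg_instr H /H E; exists k.+1.
  by rewrite E /istep /= upd_id // r0 /= size_rcons; congr (_, _); lia.
move=> r c s s' s'' /eqP r0 _ IHc _ IHw p k /=.
set body := flat _ c => Hp Ek.
have Ek1 : cfg n prog k.+1 = (p.+2, s) by rewrite (cfg_instr Hp Ek) /istep /= upd_id // (negPf r0).
have [_ ] := @code_at_cat prog p [:: Instr r OpNop (p.+1 + size body).+2 p.+2] _ Hp.
rewrite addn1 -cats1 => /code_at_cat[Hb He].
have [k2 Ek2] := IHc _ _ Hb Ek1.
have Ek3 : cfg n prog k2.+1 = (p.+1, s') by rewrite (cfg_instr He Ek2) /istep /= if_same upd_id.
by have [k3 E3] := IHw _ _ Hp Ek3; exists k3; rewrite E3 /= -cats1.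
Qed.

Lemma cfg_halted n prog k j : size prog < (cfg n prog k).1 -> k <= j ->
  size prog < (cfg n prog j).1.
Proof.
move=> lt_q; elim: j => [|j IH]; first by rewrite leqn0 => /eqP <-.
rewrite leq_eqVlt => /predU1P[<- //|/IH]; rewrite /= /mstep.
by case: (cfg n prog j) => -[|q] s //=; case: ltnP => //; lia.
Qed.

Lemma cfg_load n prog k : k <= n -> cfg n prog k = (0, upd (fun=> 0) 0 k).
Proof.
elim: k => [|k IH] lekn; first by rewrite /= upd_id.
rewrite /= IH 1?ltnW // /mstep /= lekn /istep /= if_same; congr (_, _).
by apply/funext => x; rewrite /upd; case: eqP.
Qed.

(** Register 1 receives the value [y] of [h], and register 2 ends with [1 - y], which [prog_of] then
    tests by a loop. *)
Definition run_and_test (h : murec 1) : com :=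
  seqs [:: compile h [:: 0] 1 2; Inc 2; While 1 (seqs [:: Dec 1; Dec 2])].

(* Halts if [h] takes the value 1, loops if it takes the value 0. *)
Definition prog_of (h : murec 1) := flat 1 (Seq (run_and_test h) (While 2 Skip)).

Lemma exec_run_and_test h n y : mueval h [tuple n] y -> y <= 1 ->
  exists2 s, exec (run_and_test h) (upd (fun=> 0) 0 n) s & s 2 = 1 - y.
Proof.
move=> hy y1; set s0 := upd _ _ _.
pose s1 := upd (upd s0 1 y) 2 1.
exists (upd (upd s1 1 0) 2 (1 - y)); last by [].
apply: ExecSeq (compileP _ hy _ _ _ _ _) _ => //; first by case=> [|[]].
apply: ExecSeq (ExecInc _ _) _; apply: ExecSeq (ExecSkip _).
case: y hy y1 @s1 => [|[|y]] // _ _ s1.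
  by apply: exec_eq (ExecWhile0 _ _) _ => //; apply/funext => -[|[|[|x]]].
apply: ExecWhileS => //; first exact: ExecSeq (ExecDec _ _) (ExecSeq (ExecDec _ _) (ExecSkip _)).
by apply: exec_eq (ExecWhile0 _ _) _ => //; apply/funext => -[|[|[|x]]].
Qed.

Lemma cfg_prog_of h n y : mueval h [tuple n] y -> y <= 1 -> exists m,
  [/\ code_at (prog_of h) m (flat m.+1 (While 2 Skip)), size (prog_of h) = m.+2 &
    exists k s, cfg n (prog_of h) k = (m.+1, s) /\ s 2 = 1 - y].
Proof.
move=> hy y1; set c := run_and_test h; exists (size (flat 1 c)).
have [|Hp Hw] := @code_at_cat (prog_of h) 0 (flat 1 c) (flat (size (flat 1 c)).+1 (While 2 Skip)).
  by exists [::] => //; exists [::]; rewrite cats0 /prog_of /= add1n.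
split=> //; first by rewrite /prog_of -/c [flat _ _]/= size_cat /= addn2.
have [s Es s2] := exec_run_and_test hy y1.
(* Loading takes [n] increments and one more step to leave state 0. *)
have [|k Ek] := flat_exec (n := n) (k := n.+1) Es Hp.
  by rewrite /= cfg_load // /mstep /= ltnn /istep /= if_same upd_id.
by exists k, s; rewrite Ek.
Qed.

Lemma prog_of_halts h n : mueval h [tuple n] 1 -> halts n (prog_of h).
Proof.
move=> /cfg_prog_of[//|m [Hw Es [k [s [Ek s2]]]]]; exists k.+1.
by rewrite (cfg_instr Hw Ek) /istep /= s2 Es addn0.
Qed.

(** The run is deterministic and a halted configuration stays halted, so alternating for ever
    between the last two states rules out halting at any time. *)
Lemma prog_of_loops h n : mueval h [tuple n] 0 -> ~ halts n (prog_of h).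
Proof.
move=> /cfg_prog_of[//|m [Hw Es [k [s [Ek s2]]]]] [j lt_j].
have [_] := @code_at_cat _ _ [:: Instr 2 OpNop (m.+1 + 0).+2 m.+2] [:: Instr 0 OpNop m.+1 m.+1] Hw.
rewrite addn1 => Hw2.
have loop i : cfg n (prog_of h) (k + i) = (if odd i then m.+2 else m.+1, s).
  elim: i => [|i IH]; first by rewrite addn0.
  rewrite addnS [odd _.+1]/=; case: (odd i) IH => IH; rewrite [~~ _]/=.
    by rewrite (cfg_instr Hw2 IH) /istep /= if_same upd_id.
  by rewrite (cfg_instr Hw IH) /istep /= s2 upd_id.
have := cfg_halted lt_j (leq_addl k j); rewrite loop Es; case: odd => /=; lia.
Qed.

(** * Automata over named locations *)

(** The first coordinate is 0 for the fixed locations, 1 for those of the rules, and [i.+2] inside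
    pattern [i]; a value of at least 2 thus identifies the inside of a pattern. *)
Definition loc := (nat * nat)%type.
Definition l0 : loc := (0, 0).
Definition lpriv : loc := (0, 1).
Definition lprivf : loc := (0, 2).
Definition lfin : loc := (0, 3).

Definition redge := (loc * constr 4 * {set 'I_4} * loc)%type.
Definition rsrc (e : redge) : loc := e.1.1.1.
Definition rguard (e : redge) : constr 4 := e.1.1.2.
Definition rreset (e : redge) : {set 'I_4} := e.1.2.
Definition rtgt (e : redge) : loc := e.2.

(* These edges make every nonempty timed word the trace of a private run. *)
Definition priv_edges : seq redge :=
  [:: (l0, [::], set0, lpriv); (l0, [::], set0, lprivf);
      (lpriv, [::], set0, lpriv); (lpriv, [::], set0, lprivf)].

Definition rlocs (E : seq redge) : seq loc :=
  [:: l0; lpriv; lprivf; lfin] ++ map rsrc E ++ map rtgt E.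

Definition rbound (E : seq redge) : nat := \max_(l <- rlocs E) pickle l.

Definition num_loc (E : seq redge) (l : loc) : 'I_(rbound E).+1 := inord (pickle l).

Definition mk_edge (E : seq redge) (e : redge) : edge 1 (rbound E).+1 4 :=
  Edge (num_loc E (rsrc e)) (rguard e) (Some ord0) (rreset e) (num_loc E (rtgt e)).

Definition ta_of (E : seq redge) : timed_automaton :=
  @TimedAutomaton 1 (rbound E).+1 4 (num_loc E l0)
    [set num_loc E lpriv; num_loc E lprivf] [set num_loc E lprivf; num_loc E lfin]
    [ffun=> [::]] (map (mk_edge E) (E ++ priv_edges)).

Section Automaton.
Variable E : seq redge.

Lemma num_locE l : l \in rlocs E -> num_loc E l = pickle l :> nat.
Proof.
by move=> lE; rewrite /num_loc inordK // ltnS /rbound (big_rem l) //= leq_maxl.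
Qed.

Lemma num_loc_inj : {in rlocs E &, injective (num_loc E)}.
Proof.
move=> l l' lE l'E /(congr1 val) /=; rewrite !num_locE // => /(pcan_inj pickleK).
exact.
Qed.

Lemma rlocs_src e : e \in E ++ priv_edges -> rsrc e \in rlocs E.
Proof.
rewrite mem_cat => /orP[eE|]; first by rewrite !mem_cat map_f ?orbT.
by rewrite !inE => /or4P[] /eqP ->.
Qed.

Lemma rlocs_tgt e : e \in E ++ priv_edges -> rtgt e \in rlocs E.
Proof.
rewrite mem_cat => /orP[eE|]; first by rewrite !mem_cat map_f ?orbT.
by rewrite !inE => /or4P[] /eqP ->.
Qed.

Lemma one_action_ta_of : one_action (ta_of E). Proof. by []. Qed.

Lemma no_epsilon_ta_of : no_epsilon (ta_of E).
Proof. by move=> e /mapP[e' _ ->]. Qed.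

Lemma mem_final l : l \in rlocs E ->
  (num_loc E l \in ta_final (ta_of E)) = (l \in [:: lprivf; lfin]).
Proof.
by move=> lE; rewrite !inE !(inj_in_eq num_loc_inj).
Qed.

Lemma mem_priv l : l \in rlocs E ->
  (num_loc E l \in ta_priv (ta_of E)) = (l \in [:: lpriv; lprivf]).
Proof.
by move=> lE; rewrite !inE !(inj_in_eq num_loc_inj).
Qed.

(** * Runs as paths over absolute dates, and opacity as universality *)

Section Runs.
Local Open Scope ring_scope.
Variable R : realType.

(* A valuation is represented by the last reset times of the clocks. *)
Definition resets := 'I_4 -> R.

Definition val_at (rho : resets) (t : R) : valuation R 4 := [ffun c => t - rho c].

Definition satr (rho : resets) (t : R) (g : constr 4) : bool := sat (val_at rho t) g.

Definition updr (rho : resets) (r : {set 'I_4}) (t : R) : resets :=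
  fun c => if c \in r then t else rho c.

Lemma delayed_val_at rho t d : delayed (val_at rho t) d = val_at rho (t + d).
Proof. by apply/ffunP => c; rewrite !ffunE addrAC. Qed.

Lemma reset_val_at rho t r : reset (val_at rho t) r = val_at (updr rho r t) t.
Proof. by apply/ffunP => c; rewrite !ffunE /updr; case: ifP; rewrite ?subrr. Qed.

Fixpoint rpath (l : loc) (rho : resets) (ts : seq R) (es : seq redge) : Prop :=
  match ts, es with
  | [::], [::] => True
  | t :: ts', e :: es' => [/\ e \in E ++ priv_edges, rsrc e = l, satr rho t (rguard e) &
      rpath (rtgt e) (updr rho (rreset e) t) ts' es']
  | _, _ => False
  end.

Let A := ta_of E.

Definition word_of (ts : seq R) : timed_word R A := [seq (ord0 : action A, t) | t <- ts].

Definition state_at (l : loc) (rho : resets) (t : R) : state R A :=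
  (num_loc E l, val_at rho t).

Lemma run_rpath (run : step_seq R A) l rho t : l \in rlocs E ->
  steps_from (state_at l rho t) run ->
  exists ts es, [/\ rpath l rho ts es, path <=%R t ts, trace_from t run = word_of ts &
    next_locs run = [seq num_loc E (rtgt e) | e <- es]].
Proof.
elim: run l rho t => [|[[d e] c] run IH] l rho t lE /=.
  by move=> _; exists [::], [::].
move=> [[c1 [d0 _ ->] [/mapP[e' e'E ->] /= Esrc Hg -> _]] _].
rewrite delayed_val_at reset_val_at => H.
have [ts [es [Hp Hs Ht Hl]]] := IH _ _ _ (rlocs_tgt e'E) H.
exists (t + d :: ts), (e' :: es); split=> //=.
- split=> //; first by apply: num_loc_inj => //; exact: rlocs_src.
  by move: Hg; rewrite /= delayed_val_at.
- by rewrite lerDl d0.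
- by rewrite Ht.
- by rewrite Hl.
Qed.

(** The bound on [rho] keeps the clocks nonnegative, as configurations require. *)
Lemma rpath_run ts es l rho t : rpath l rho ts es -> path <=%R t ts ->
  (forall c, rho c <= t) ->
  exists run : step_seq R A, [/\ steps_from (state_at l rho t) run,
    trace_from t run = word_of ts &
    next_locs run = [seq num_loc E (rtgt e) | e <- es]].
Proof.
elim: ts es l rho t => [|t' ts IH] [|e es] l rho t //=; first by exists [::].
move=> [eE Esrc Hg Hp] /andP[let' Hs] Hrho.
have Hrho' c : updr rho (rreset e) t' c <= t'.
  by rewrite /updr; case: ifP => // _; exact: le_trans (Hrho c) _.
have [run [H1 H2 H3]] := IH _ _ _ _ Hp Hs Hrho'.
exists ((t' - t, mk_edge E e, state_at (rtgt e) (updr rho (rreset e) t') t') :: run).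
split=> /=; last by rewrite H3.
  split=> //; last first.
    by split=> /= [c|]; rewrite ffunE // subr_ge0.
  exists (state_at l rho t').
    split=> /=; first by rewrite subr_ge0.
      by move=> d' _; rewrite ffunE.
    by rewrite delayed_val_at addrC subrK.
  split=> //=; first by apply: map_f.
  - by rewrite Esrc.
  - by rewrite reset_val_at.
  - by rewrite ffunE.
by rewrite addrC subrK H2.
Qed.

Lemma init_val_at : init_state R A = state_at l0 (fun=> 0) 0.
Proof. by congr (_, _); apply/ffunP => c; rewrite !ffunE subrr. Qed.

(** The initial location is not final, and every edge is observable. *)
Lemma trace_nonempty (run : step_seq R A) : is_run run ->
  exists t ts, trace run = word_of (t :: ts) /\ path <=%R 0 (t :: ts).
Proof.
case=> _; rewrite init_val_at => /run_rpath[//|ts [es [Hp Hs Ht Hl]]] Hf _.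
rewrite /trace Ht; case: ts Hp Hs {Ht} => [|t ts]; last by exists t, ts.
by case: es Hl => //= Hl; move: Hf; rewrite Hl /= mem_final.
Qed.

Lemma is_config_init : is_config (init_state R A).
Proof. by split=> [x|]; rewrite ffunE. Qed.

Lemma word_private t ts : path <=%R 0 (t :: ts) -> PrivTr (word_of (t :: ts)).
Proof.
move=> Hs.
pose f (l l' : loc) : redge := (l, [::], set0, l').
pose es := if ts is _ :: ts' then
  f l0 lpriv :: rcons (nseq (size ts') (f lpriv lpriv)) (f lpriv lprivf) else [:: f l0 lprivf].
have fE l l' : f l l' \in priv_edges -> f l l' \in E ++ priv_edges.
  by rewrite mem_cat => ->; rewrite orbT.
have Hp : rpath l0 (fun=> 0) (t :: ts) es.
  rewrite /es; case: ts {Hs es} => [|t' ts] /=.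
    by split=> //; apply: fE; rewrite !inE eqxx ?orbT.
  split=> //; first by apply: fE; rewrite !inE eqxx ?orbT.
  move: (updr _ _ _) => rho; elim: ts t' rho => [|t'' ts IH] t' rho /=.
    by split=> //; apply: fE; rewrite !inE eqxx ?orbT.
  split=> //; first by apply: fE; rewrite !inE eqxx ?orbT.
  exact: IH.
have [|run [H1 H2 H3]] := rpath_run Hp Hs; first by [].
exists run => //; rewrite -init_val_at in H1.
have Etgt : [seq num_loc E (rtgt e) | e <- es] =
    rcons (nseq (size ts) (num_loc E lpriv)) (num_loc E lprivf).
  rewrite /es; case: ts {Hs es Hp H2 H3} => [|_ ts] //=; congr cons.
  by rewrite map_rcons map_nseq.
split; last by rewrite /private_run H3 Etgt /= has_rcons !mem_priv.
split=> //; first exact: is_config_init.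
- by rewrite H3 Etgt last_rcons mem_final.
rewrite H3 Etgt belast_rcons /= mem_final //=.
by rewrite all_nseq /= mem_final // orbT.
Qed.

(** Acceptance by public runs: the edges of [priv_edges] are left out, and acceptance means entering
    [lfin] on the last letter, because a run stops at its first final location. *)
Fixpoint acc (ts : seq R) (l : loc) (rho : resets) : Prop :=
  if ts is t :: ts' then
    exists e, [/\ e \in E, rsrc e = l, satr rho t (rguard e) &
      (rtgt e = lfin /\ ts' = [::]) \/ acc ts' (rtgt e) (updr rho (rreset e) t)]
  else False.

Definition public_edges := all (fun e =>
  (rsrc e != lfin) && (rtgt e \notin [:: lpriv; lprivf])) E.

Hypothesis pubE : public_edges.

Lemma rpath_locs ts es l rho : rpath l rho ts es -> all [in rlocs E] (map rtgt es).
Proof.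
elim: ts es l rho => [|t ts IH] [|e es] l rho //= [eE _ _ /IH ->].
by rewrite andbT; exact: rlocs_tgt.
Qed.

Lemma rpath_acc ts es l rho : rpath l rho ts es ->
  last l (map rtgt es) \in [:: lprivf; lfin] ->
  all [predC [:: lprivf; lfin]] (belast l (map rtgt es)) ->
  ~~ has [in [:: lpriv; lprivf]] (map rtgt es) -> l \notin [:: lprivf; lfin] -> acc ts l rho.
Proof.
elim: ts es l rho => [|t ts IH] [|e es] l rho //=; first by move=> _ ->.
move=> [eE Esrc Hg Hp] Hlast /andP[_ Hbel] /norP[pubtgt Hpub] _.
have {}eE : e \in E.
  move: eE; rewrite mem_cat => /orP[//|].
  by rewrite !inE => /or4P[] /eqP Ee; rewrite Ee in pubtgt.
exists e; split=> //.
case: es Hp Hlast Hbel Hpub => [|e' es] Hp Hlast Hbel Hpub.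
  left; split; last by case: ts Hp {IH}.
  by move: pubtgt Hlast; rewrite !inE /= => /norP[_ /negPf ->] /eqP.
by right; apply: IH Hp Hlast (Hbel) Hpub _; case/andP: Hbel.
Qed.

Lemma acc_rpath ts l rho : acc ts l rho -> l \notin [:: lprivf; lfin] ->
  exists es, [/\ rpath l rho ts es, last l (map rtgt es) \in [:: lprivf; lfin],
  all [predC [:: lprivf; lfin]] (belast l (map rtgt es)) &
  ~~ has [in [:: lpriv; lprivf]] (map rtgt es)].
Proof.
elim: ts l rho => [|t ts IH] l rho //= [e [eE Esrc Hg Hacc]] lnf.
have eE' : e \in E ++ priv_edges by rewrite mem_cat eE.
have /andP[_ tgtnp] := allP pubE _ eE.
case: Hacc => [[Et ->]|Hacc].
  exists [:: e]; split=> //=; rewrite ?Et //.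
  by rewrite andbT; exact: lnf.
have tgtnf : rtgt e \notin [:: lprivf; lfin].
  move: tgtnp; rewrite !inE !negb_or => /andP[_ -> /=]; apply/eqP => Et.
  case: ts Hacc {IH} => [|t' ts] //= [e' [e'E Ee' _ _]].
  by have /andP[] := allP pubE _ e'E; rewrite Ee' Et.
have [es [H1 H2 H3 H4]] := IH _ _ Hacc tgtnf.
by exists (e :: es); split=> //=; [rewrite lnf|rewrite negb_or tgtnp].
Qed.

Lemma final_locs l ls : l \in rlocs E -> all [in rlocs E] ls ->
  ((last (num_loc E l) (map (num_loc E) ls) \in ta_final A) =
     (last l ls \in [:: lprivf; lfin])) *
  (all [predC ta_final A] (belast (num_loc E l) (map (num_loc E) ls)) =
     all [predC [:: lprivf; lfin]] (belast l ls)) *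
  (has [in ta_priv A] (map (num_loc E) ls) = has [in [:: lpriv; lprivf]] ls).
Proof.
elim: ls l => [|l' ls IH] l lE /=; first by rewrite mem_final.
move=> /andP[l'E lsE]; have [[-> ->] ->] := IH _ l'E lsE.
by rewrite mem_final // mem_priv.
Qed.

Lemma word_public ts : path <=%R 0 ts ->
  PubTr (word_of ts) <-> acc ts l0 (fun=> 0).
Proof.
move=> Hs; split.
  case=> run [[_ H1 H2 H3] Hpub] Ht; rewrite init_val_at in H1.
  have [//|ts' [es [Hp _ Ht' Hl]]] := run_rpath _ H1.
  have Ets : ts = ts'.
    by move: Ht; rewrite /trace Ht' => /(congr1 (map snd)); rewrite -!map_comp !map_id.
  rewrite -{ts' Ht'}Ets in Hp; move: H2 H3 Hpub.
  have lsE := rpath_locs Hp.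
  have [//|[Elast Ebelast] Epriv] := @final_locs l0 _ _ lsE.
  rewrite /private_run {}Hl (map_comp (num_loc E)) /= negb_or Elast Ebelast Epriv.
  move=> H2 H3 /andP[_ H4].
  exact: rpath_acc Hp H2 H3 H4 _.
move=> /acc_rpath[//|es [Hp H1 H2 H3]].
have [//|run [R1 R2 R3]] := rpath_run Hp Hs.
have lsE := rpath_locs Hp.
have [//|[Elast Ebelast] Epriv] := @final_locs l0 _ _ lsE.
exists run; last exact: R2.
rewrite (map_comp (num_loc E)) in R3.
split; last by rewrite /private_run R3 /= Epriv negb_or mem_priv.
split; first exact: is_config_init.
- by rewrite init_val_at.
- by rewrite R3 Elast.
- by rewrite R3 Ebelast.
Qed.

Definition universal := forall t ts, path <=%R 0 (t :: ts) -> acc (t :: ts) l0 (fun=> 0).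

Lemma weakly_opaque_universal : weakly_opaque R A <-> universal.
Proof.
split=> [op t ts Hs|uni w [run [Hrun _] <-]].
  exact/(word_public Hs)/op/word_private.
have [t [ts [-> Hs]]] := trace_nonempty Hrun.
exact/(word_public Hs)/uni.
Qed.

(** The inclusion of the public traces in the private ones always holds, as every trace is nonempty;
    only the weak half carries information. *)
Lemma fully_opaque_universal : fully_opaque R A <-> universal.
Proof.
rewrite -weakly_opaque_universal; split=> [op w|]; first by rewrite op.
move=> wop; apply/classical_sets.seteqP; split=> // w [run [Hrun _] <-].
by have [t [ts [-> Hs]]] := trace_nonempty Hrun; apply: word_private.
Qed.

End Runs.
End Automaton.

(** * Patterns of events *)

(* An item is an edge, given by its guard and its reset set, together with the
   guards of the loops around its target. A pattern is the location from which
   the first edge leaves and the list of its items. *)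
Definition item := (constr 4 * {set 'I_4} * seq (constr 4))%type.
Definition pattern := (loc * seq item)%type.

Definition lchain (i j : nat) : loc := (i.+2, j).

Definition item0 : item := ([::], set0, [::]).

Definition item_src (p : pattern) (i j : nat) : loc :=
  if j is j'.+1 then lchain i j' else p.1.

(** The last location of a chain has loops, so it cannot itself be final. Instead each edge into it
    has a twin into [lfin], to be taken on the last letter. *)
Definition item_edges (p : pattern) (i j : nat) : seq redge :=
  let it := nth item0 p.2 j in
  [:: (item_src p i j, it.1.1, it.1.2, lchain i j)] ++
  [seq (lchain i j, h, set0, lchain i j) | h <- it.2] ++
  if j.+1 == size p.2 then
    (item_src p i j, it.1.1, it.1.2, lfin) :: [seq (lchain i j, h, set0, lfin) | h <- it.2]
  else [::].

Definition pat_edges (p : pattern) (i : nat) : seq redge :=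
  flatten [seq item_edges p i j | j <- iota 0 (size p.2)].

Definition pat0 : pattern := (l0, [::]).

Definition pats_edges (ps : seq pattern) : seq redge :=
  flatten [seq pat_edges (nth pat0 ps i) i | i <- iota 0 (size ps)].

Lemma mem_pats_edges ps i j e : i < size ps -> j < size (nth pat0 ps i).2 ->
  e \in item_edges (nth pat0 ps i) i j -> e \in pats_edges ps.
Proof.
move=> lti ltj eE; apply/flatten_mapP; exists i; first by rewrite mem_iota.
by apply/flatten_mapP; exists j => //; rewrite mem_iota.
Qed.

Lemma pats_edgesP ps e : e \in pats_edges ps ->
  exists i j, [/\ i < size ps, j < size (nth pat0 ps i).2 &
    e \in item_edges (nth pat0 ps i) i j].
Proof.
case/flatten_mapP => i; rewrite mem_iota /= => lti /flatten_mapP[j].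
by rewrite mem_iota /= => ltj eE; exists i, j.
Qed.

Section Matching.
Local Open Scope ring_scope.
Variable R : realType.
Implicit Types (rho : resets R) (b ts : seq R) (t s : R) (L : seq (constr 4)).

Definition sat_some L rho t := has (satr rho t) L.

Fixpoint matches (its : seq item) L rho ts : Prop :=
  if its is it :: its' then
    exists a t b, [/\ ts = a ++ t :: b, all (sat_some L rho) a, satr rho t it.1.1 &
      matches its' it.2 (updr rho it.1.2 t) b]
  else all (sat_some L rho) ts.

Lemma updr0 rho t : updr rho set0 t = rho.
Proof. by apply/funext => c; rewrite /updr inE. Qed.

Section Acceptance.
Variables (B : seq redge) (ps : seq pattern).

Let E := B ++ pats_edges ps.

Lemma acc_loop l rho h b t : (l, h, set0, l) \in E -> satr rho t h ->
  acc E b l rho -> acc E (t :: b) l rho.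
Proof. by move=> eE Hh Hacc; exists (l, h, set0, l); split=> //; right; rewrite /= updr0. Qed.

Lemma acc_loops l L rho a b : (forall h, h \in L -> (l, h, set0, l) \in E) ->
  all (sat_some L rho) a -> acc E b l rho -> acc E (a ++ b) l rho.
Proof.
move=> HL; elim: a => [|t a IH] //= /andP[/hasP[h hL Hh] Ha] Hb.
by apply: acc_loop Hh _; [exact: HL|exact: IH].
Qed.

Lemma acc_skip l rho a b : (l, [::], set0, l) \in E -> acc E b l rho -> acc E (a ++ b) l rho.
Proof.
move=> eE; apply: (@acc_loops _ [:: [::]]) => [h|]; first by rewrite inE => /eqP ->.
by elim: a.
Qed.

Lemma matches_acc i j its L rho ts : (i < size ps)%N -> drop j (nth pat0 ps i).2 = its ->
  its != [::] -> (forall h, h \in L -> (item_src (nth pat0 ps i) i j, h, set0,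
    item_src (nth pat0 ps i) i j) \in E) ->
  matches its L rho ts -> acc E ts (item_src (nth pat0 ps i) i j) rho.
Proof.
set p := nth pat0 ps i => lti.
elim: its j L rho ts => [|it its IH] j L rho ts //= Ej _ HL [a [t [b [-> Ha Ht Hb]]]].
have ltj : (j < size p.2)%N by rewrite ltnNge; apply/negP => /drop_oversize; rewrite Ej.
have [Eit Eits] : nth item0 p.2 j = it /\ drop j.+1 p.2 = its.
  by move: Ej; rewrite (drop_nth item0) // => -[].
have inE' e : e \in item_edges p i j -> e \in E.
  by move=> eE; rewrite mem_cat (mem_pats_edges lti ltj eE) orbT.
apply: acc_loops HL Ha _.
have HL' h : h \in it.2 -> (lchain i j, h, set0, lchain i j) \in E.
  by move=> hL; apply: inE'; rewrite /item_edges Eit !mem_cat map_f ?orbT.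
case: its IH Eits Hb {Ej} => [|it' its] IH Eits Hb.
  have Esz : j.+1 == size p.2.
    by rewrite eqn_leq ltj -subn_eq0 -size_drop Eits.
  have inEf e : e \in (item_src p i j, it.1.1, it.1.2, lfin) ::
      [seq (lchain i j, h, set0, lfin) | h <- it.2] -> e \in E.
    by move=> eE; apply: inE'; rewrite /item_edges Eit Esz !mem_cat eE !orbT.
  move: Hb; case/lastP: b => [|b t'] /=.
    by exists (item_src p i j, it.1.1, it.1.2, lfin); split=> //;
      [apply: inEf; rewrite inE eqxx|left].
  rewrite all_rcons => /andP[/hasP[h hL Hh] Hb].
  exists (item_src p i j, it.1.1, it.1.2, lchain i j); split=> //.
    by apply: inE'; rewrite /item_edges Eit inE eqxx.
  right; rewrite -cats1; apply: acc_loops HL' Hb _.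
  exists (lchain i j, h, set0, lfin); split=> //; last by left.
  by apply: inEf; rewrite inE map_f ?orbT.
exists (item_src p i j, it.1.1, it.1.2, lchain i j); split=> //.
  by apply: inE'; rewrite /item_edges Eit inE eqxx.
by right; apply: (IH j.+1 it.2) => //.
Qed.

Lemma pattern_acc p rho ts : p \in ps -> p.2 != [::] -> (p.1, [::], set0, p.1) \in E ->
  matches p.2 [:: [::]] rho ts -> acc E ts p.1 rho.
Proof.
move=> /(nthP pat0)[i lti Ep] pn0 eE.
have := @matches_acc i 0 p.2 [:: [::]] rho ts lti; rewrite Ep drop0; apply=> // h.
by rewrite inE => /eqP ->.
Qed.

Lemma pattern_acc_first p it its rho t b : p \in ps -> p.2 = it :: its ->
  satr rho t it.1.1 -> matches its it.2 (updr rho it.1.2 t) b -> acc E (t :: b) p.1 rho.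
Proof.
move=> /(nthP pat0)[i lti Ep] Ep2 Ht Hb.
have := @matches_acc i 0 p.2 [::] rho (t :: b) lti; rewrite Ep drop0; apply=> //.
  by rewrite Ep2.
by rewrite Ep2; exists [::], t, b.
Qed.

Hypothesis B_src : all (fun e => (rsrc e).1 < 2)%N B.
Hypothesis ps_src : all (fun p : pattern => p.1.1 < 2)%N ps.
Hypothesis pubE : public_edges E.

Lemma acc_fin ts rho : ~ acc E ts lfin rho.
Proof.
case: ts => [|t ts] //= [e [eE Ee _ _]].
by have := allP pubE _ eE; rewrite Ee eqxx.
Qed.

(** The name of a chain location determines its pattern and item, and base edges and pattern starts
    lie elsewhere. So only its loops, the edges of the next item, and their twins into [lfin] leave
    it. *)
Lemma acc_matches i j rho ts : (i < size ps)%N -> (j < size (nth pat0 ps i).2)%N ->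
  acc E ts (lchain i j) rho ->
  matches (drop j.+1 (nth pat0 ps i).2) (nth item0 (nth pat0 ps i).2 j).2 rho ts.
Proof.
move=> lti; elim: ts j rho => [|t ts IH] j rho ltj //= [e [eE Ee Ht Hacc]].
move: eE; rewrite mem_cat => /orP[/(allP B_src)|]; first by rewrite Ee.
case/pats_edgesP => i' [j' [lti' ltj']].
have start' : ((nth pat0 ps i').1.1 < 2)%N by exact: (allP ps_src) (mem_nth _ _).
have src_eq : rsrc e = item_src (nth pat0 ps i') i' j' -> i' = i /\ j' = j.+1.
  rewrite Ee; case: (j') => [|j''] /= E0; first by rewrite -E0 in start'.
  by case: E0 => -> ->.
rewrite !mem_cat => /or3P[]; last case: eqP => // Esz; rewrite ?inE.
- move=> /eqP E1; have [E2 E3] := src_eq (congr1 rsrc E1).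
  subst i' j'; move: Ht Hacc; rewrite {}E1 /= => Ht [[]//|/IH-/(_ ltj') Hm].
  by rewrite (drop_nth item0) //; exists [::], t, ts.
- case/mapP => h hL E1; move: Ee Ht Hacc; rewrite {}E1 => -[E2 E3] Ht [[]//|].
  subst i' j'; rewrite /= updr0 => /IH-/(_ ltj').
  have Hh : sat_some (nth item0 (nth pat0 ps i).2 j).2 rho t by apply/hasP; exists h.
  case: (drop _ _) => [|it its] /=; first by rewrite Hh.
  by case=> a [t' [b [-> Ha ? ?]]]; exists (t :: a), t', b; split=> //=; rewrite Hh.
case/orP => [/eqP E1|].
  have [E2 E3] := src_eq (congr1 rsrc E1).
  subst i' j'; move: Ht Hacc; rewrite {}E1 /= => Ht [[_ ->]|/acc_fin //].
  rewrite (drop_nth item0) // drop_oversize ?Esz //.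
  by exists [::], t, [::].
case/mapP => h hL E1; move: Ee Ht Hacc; rewrite {}E1 => -[E2 E3] Ht [[_ ->]|/acc_fin //].
subst i' j'; rewrite drop_oversize ?Esz //= andbT.
by apply/hasP; exists h.
Qed.

Lemma acc_start l t ts rho : (l.1 < 2)%N -> acc E (t :: ts) l rho ->
  (exists e, [/\ e \in B, rsrc e = l, satr rho t (rguard e) &
      (rtgt e = lfin /\ ts = [::]) \/ acc E ts (rtgt e) (updr rho (rreset e) t)]) \/
  exists p it its, [/\ p \in ps, p.1 = l, p.2 = it :: its, satr rho t it.1.1 &
      matches its it.2 (updr rho it.1.2 t) ts].
Proof.
move=> lt_l [e [eE Ee Ht Hacc]].
move: eE; rewrite mem_cat => /orP[eB|]; first by left; exists e.
case/pats_edgesP => i [j [lti ltj]] eE; right.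
have notchain i' j' : lchain i' j' <> l by move=> E1; rewrite -E1 in lt_l.
exists (nth pat0 ps i), (nth item0 (nth pat0 ps i).2 0), (behead (nth pat0 ps i).2).
have Ej : rsrc e = item_src (nth pat0 ps i) i j -> j = 0%N.
  by rewrite Ee; case: (j) => // j' /esym/notchain.
have nn : (0 < size (nth pat0 ps i).2)%N by exact: leq_ltn_trans ltj.
have Ebh : (nth pat0 ps i).2 = nth item0 (nth pat0 ps i).2 0 :: behead (nth pat0 ps i).2.
  by case: (nth pat0 ps i).2 nn.
have pin : nth pat0 ps i \in ps by exact: mem_nth.
move: eE; rewrite !mem_cat => /or3P[]; last case: eqP => // Esz; rewrite ?inE.
- move=> /eqP E1; have E3 := Ej (congr1 rsrc E1); subst j.
  move: Ee Ht Hacc; rewrite {}E1 /= => Ee Ht [[]//|/acc_matches].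
  by rewrite drop1 => /(_ lti nn).
- by case/mapP => h hL E1; move: Ee; rewrite E1 => /notchain.
case/orP => [/eqP E1|]; last by case/mapP => h hL E1; move: Ee; rewrite E1 => /notchain.
have E3 := Ej (congr1 rsrc E1); subst j.
move: Ee Ht Hacc; rewrite {}E1 /= => Ee Ht [[_ ->]|/acc_fin //].
split=> //; case: (behead _) Ebh => // it its E2.
by move: Esz; rewrite E2.
Qed.

End Acceptance.

(* [b] consists of the events of [ts] after [t], and possibly copies of [t]. *)
Definition tail_of ts t b : Prop :=
  [/\ sorted <=%R b, {subset b <= ts}, forall s, s \in ts -> t < s -> s \in b &
      forall s, s \in b -> t <= s].

Lemma tail_of_trans ts t t' b b' : t <= t' -> tail_of ts t b -> tail_of b t' b' ->
  tail_of ts t' b'.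
Proof.
move=> lett' [_ H1 H2 _] [H3 H4 H5 H6]; split=> //.
- by move=> s /H4/H1.
- by move=> s sts lts; apply: H5 => //; apply: H2 => //; exact: le_lt_trans lts.
Qed.

Lemma tail_of_cat a t b : sorted <=%R (a ++ t :: b) -> tail_of (a ++ t :: b) t b.
Proof.
move=> Hs; have [_ Htb] := cat_sorted2 Hs.
have lea s : s \in a -> s <= t.
  by move=> sa; have := Hs; rewrite sorted_pairwise ?pairwise_cat;
    [move=> /and3P[/allrelP/(_ s t sa)->]; rewrite ?inE ?eqxx|exact: le_trans].
split=> //.
- exact: path_sorted Htb.
- by move=> s sb; rewrite mem_cat inE sb !orbT.
- move=> s; rewrite mem_cat inE => /or3P[/lea|/eqP ->|//]; last by rewrite ltxx.
  by move=> H1 H2; have := lt_le_trans H2 H1; rewrite ltxx.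
- by move=> s sb; exact: (allP (order_path_min le_trans Htb)).
Qed.

Lemma split_first t b : sorted <=%R b -> t \in b -> exists a b',
  [/\ b = a ++ t :: b', forall s, s \in a -> s < t & tail_of b t b'].
Proof.
move=> Hs tb; exists (take (index t b) b), (drop (index t b).+1 b).
have E1 : b = take (index t b) b ++ t :: drop (index t b).+1 b.
  by rewrite -{2}(nth_index t tb) -drop_nth ?index_mem // cat_take_drop.
split=> //; last by rewrite {1}E1; apply: tail_of_cat; rewrite -E1.
move=> s sa; rewrite lt_neqAle; apply/andP; split.
  by apply: contraTneq sa => ->; rewrite in_take_leq ?index_size // ltnn.
move: Hs; rewrite {1}E1 sorted_pairwise ?pairwise_cat; last exact: le_trans.
by move=> /and3P[/allrelP/(_ s t sa)->]; rewrite ?inE ?eqxx.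
Qed.

(** Taking the first occurrence of [t] leaves only strictly earlier events to the loops. Copies of
    [t] may remain in the tail, whence the quantification over [b']. *)
Lemma matches_intro it its L rho b t : sorted <=%R b -> t \in b ->
  (forall s, s \in b -> s < t -> sat_some L rho s) -> satr rho t it.1.1 ->
  (forall b', tail_of b t b' -> matches its it.2 (updr rho it.1.2 t) b') ->
  matches (it :: its) L rho b.
Proof.
move=> Hs tb HL Ht Hb; have [a [b' [Eb Ha Htl]]] := split_first Hs tb.
exists a, t, b'; split=> //; last exact: Hb.
by apply/allP => s sa; apply: HL (Ha s sa); rewrite Eb mem_cat sa.
Qed.

Lemma matches_elim it its L rho b : sorted <=%R b -> matches (it :: its) L rho b ->
  exists t b', [/\ t \in b, forall s, s \in b -> s < t -> sat_some L rho s,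
    satr rho t it.1.1, tail_of b t b' & matches its it.2 (updr rho it.1.2 t) b'].
Proof.
move=> Hs [a [t [b' [Eb Ha Ht Hb']]]]; exists t, b'; subst b.
have Htl := tail_of_cat Hs; split=> //; first by rewrite mem_cat inE eqxx orbT.
move=> s; rewrite mem_cat => /orP[/(allP Ha)//|].
rewrite inE => /predU1P[->|]; first by rewrite ltxx.
by case: Htl => _ _ _ H /H; rewrite leNgt => /negPf ->.
Qed.

End Matching.

(** * Encoding of runs by timed words *)

Arguments satr : simpl never.

Definition cz : 'I_4 := @Ordinal 4 0 isT.
Definition cx : 'I_4 := @Ordinal 4 1 isT.
Definition cy : 'I_4 := @Ordinal 4 2 isT.
Definition cw : 'I_4 := @Ordinal 4 3 isT.

Definition lphase : loc := (0, 4).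
Definition lrule (i : nat) : loc := (1, i).

Definition atom (c : 'I_4) (k : cmp) (d : nat) : 'I_4 * cmp * int := (c, k, Posz d).

(** A disequality is not a guard, but two loops, one below and one above [d], have the same
    effect. *)
Definition neq_guards (c : 'I_4) (d : nat) : seq (constr 4) :=
  [:: [:: atom c CLt d]; [:: atom c CGt d]].

Definition any_guard : seq (constr 4) := [:: [::]].

Definition in_unit (d : nat) : constr 4 := [:: atom cz CGe d; atom cz CLt d.+1].

Inductive when := Always | Before | After.

Record rule := Rule { rwhen : when; rstate : nat; rinstr : instr }.

Definition rule0 := Rule Always 0 nop_instr.

(** The first two rules are the behaviours of state 0 during and after loading. They alone are
    timed, so [n] occurs in no other edge. *)
Definition rules (prog : seq instr) : seq rule :=
  [:: Rule Before 0 (Instr 0 OpInc 0 0), Rule After 0 (Instr 0 OpNop 1 1) &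
      [seq Rule Always q.+1 (nth nop_instr prog q) | q <- iota 0 (size prog)]].

Section Layout.
Variable prog : seq instr.

Definition nstates : nat := (\max_(r <- rules prog)
  maxn (rstate r) (maxn (ijz (rinstr r)) (ijn (rinstr r)))).+1.

Definition nregs : nat := (\max_(r <- rules prog) ireg (rinstr r)).+1.

(* A configuration occupies a period of length [period]: at offset 0 an anchor,
   at offset q + 1 the event of the state q, in [grid, grid + 1[ the grid, and in
   [marker j, marker j + 1[ a marker at the fractional part of the v-th grid
   point if v is the value of register j. *)
Definition grid : nat := nstates.+1.
Definition marker (j : nat) : nat := grid.+1 + j.
Definition period : nat := grid.+1 + nregs.

Definition when_guard (n : nat) (w : when) : constr 4 :=
  match w with
  | Always => [::]
  | Before => [:: atom cw CLt (n * period)]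
  | After => [:: atom cw CGe (n * period)]
  end.

Definition rule_edge (n i : nat) (r : rule) : redge :=
  (lphase, atom cz CEq (rstate r).+1 :: when_guard n (rwhen r), [set cx], lrule i).

Definition phase_edges : seq redge :=
  [:: (l0, [::], setT, lphase); (lphase, [::], set0, lphase);
      (lphase, [:: atom cz CEq period], [set cz], lphase)].

Definition rule_loops : seq redge :=
  [seq (lrule i, [::], set0, lrule i) | i <- iota 0 (size (rules prog))].

(* The events of the two items are consecutive, up to repetitions of the first
   one: [cx] still has value 0 at all events in between. *)
Definition next_grid (g : constr 4) (its : seq item) : seq item :=
  [:: (in_unit grid, [set cx], [:: [:: atom cx CEq 0]]),
      (atom cx CGt 0 :: g, [set cy], any_guard) & its].

Definition init_patterns : seq pattern :=
  [seq (l0, [:: ([::], setT, neq_guards cw d)])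
     | d <- [:: 1, grid & [seq marker j | j <- iota 0 nregs]]].

(** The third event lies strictly between the translates, by one period, of a grid point and of the
    event that follows it. That follower may lie beyond the grid, so the bound on [cz] keeps the
    third event within the next grid. *)
Definition new_grid_point : pattern :=
  (lphase, next_grid [::]
    [:: ([:: atom cx CGt period; atom cy CLt period; atom cz CLt (period + grid.+1)],
         set0, any_guard)]).

Definition marker_unchanged (j : nat) : seq item :=
  [:: (in_unit (marker j), [set cx], neq_guards cx period)].

(** [cx] has been reset at offset [q.+1], so [period + jz - q] later is offset [jz.+1] of the next
    period. Value 0 is a marker at offset [marker a] exactly, since the grid starts at fractional
    part 0. As [marker a = grid + a.+1], a marker comes [a.+1] after its grid point; with [cx] reset
    at a grid point and [cy] at its successor, an increment goes from [cx] to [cy] and a decrement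
    from [cy] to [cx]. *)
Definition rule_violations (r : rule) : seq (seq item) :=
  let: Rule _ q (Instr a o jz jn) := r in
  [:: [:: ([:: atom cz CEq (marker a)], set0, neq_guards cx (period + jz - q))];
      [:: ([:: atom cz CGt (marker a); atom cz CLt (marker a).+1], set0,
           neq_guards cx (period + jn - q))];
      [:: ([:: atom cz CEq grid], set0, neq_guards cx (period - q.+1))];
      [:: (in_unit grid, [set cx], neq_guards cx period)]] ++
  [seq marker_unchanged j | j <- [seq j <- iota 0 nregs | j != a]] ++
  match o with
  | OpNop => [:: marker_unchanged a]
  | OpInc =>
    [:: next_grid [:: atom cz CLt grid.+1]
          [:: ([:: atom cx CEq a.+1], set0, neq_guards cy (period + a.+1))];
        [:: (in_unit grid, [set cx], [:: [:: atom cx CEq 0]; [:: atom cz CGe grid.+1]]);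
            ([:: atom cx CEq a.+1], set0, any_guard)]]
  | OpDec =>
    [:: [:: ([:: atom cz CEq (marker a)], [set cx], neq_guards cx period)];
        next_grid [:: atom cz CLt grid.+1]
          [:: ([:: atom cy CEq a.+1], set0, neq_guards cx (period + a.+1))]]
  end.

Definition rule_patterns : seq pattern :=
  flatten [seq [seq (lrule i, its) | its <- rule_violations (nth rule0 (rules prog) i)]
             | i <- iota 0 (size (rules prog))].

Definition patterns : seq pattern := init_patterns ++ [:: new_grid_point] ++ rule_patterns.

Definition base_edges (n : nat) : seq redge :=
  [seq rule_edge n i (nth rule0 (rules prog) i) | i <- iota 0 (size (rules prog))] ++
  phase_edges ++ rule_loops.

Definition edges (n : nat) : seq redge := base_edges n ++ pats_edges patterns.

End Layout.

Arguments edges : simpl never.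
Arguments patterns : simpl never.
Arguments nstates : simpl never.
Arguments nregs : simpl never.
Arguments grid : simpl never.
Arguments marker : simpl never.
Arguments period : simpl never.

Lemma leq_max_nth (T : Type) (x0 : T) (s : seq T) (F : T -> nat) i :
  i < size s -> F (nth x0 s i) <= \max_(x <- s) F x.
Proof.
move=> lti; rewrite (big_nth x0) big_mkord.
exact: (@leq_bigmax _ (fun j : 'I_(size s) => F (nth x0 s j)) (Ordinal lti)).
Qed.

Section Bounds.
Variables (n : nat) (prog : seq instr).

Lemma rule_bounds i : i < size (rules prog) ->
  [/\ rstate (nth rule0 (rules prog) i) < nstates prog,
      ijz (rinstr (nth rule0 (rules prog) i)) < nstates prog,
      ijn (rinstr (nth rule0 (rules prog) i)) < nstates prog &
      ireg (rinstr (nth rule0 (rules prog) i)) < nregs prog].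
Proof.
move=> lti; have := leq_max_nth rule0 (fun r => ireg (rinstr r)) lti.
have := leq_max_nth rule0 (fun r => maxn (rstate r) (maxn (ijz (rinstr r)) (ijn (rinstr r)))) lti.
rewrite /nstates /nregs /=; move: (\max_(_ <- _) _) (\max_(_ <- _) _) => a b.
by rewrite !geq_max => /and3P[? ? ?] ?; split; lia.
Qed.

Lemma patternsP p : p \in patterns prog ->
  [\/ exists2 d, d \in [:: 1, grid prog & [seq marker prog j | j <- iota 0 (nregs prog)]] &
        p = (l0, [:: ([::], setT, neq_guards cw d)]),
      p = new_grid_point prog |
      exists i its, [/\ i < size (rules prog),
        its \in rule_violations prog (nth rule0 (rules prog) i) & p = (lrule i, its)]].
Proof.
rewrite 2!mem_cat mem_seq1 => /or3P[/mapP[d ? ->]|/eqP ->|].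
- by constructor 1; exists d.
- by constructor 2.
case/flatten_mapP => i; rewrite mem_iota => /= lti /mapP[its ? ->].
by constructor 3; exists i, its.
Qed.

Lemma patterns_src : all (fun p : pattern => p.1.1 < 2) (patterns prog).
Proof. by apply/allP => p /patternsP[[d _ ->]|->|[i [its [_ _ ->]]]]. Qed.

Lemma patterns_nonempty p : p \in patterns prog -> p.2 != [::].
Proof.
case/patternsP => [[d _ ->]|->|[i [its [_ Hits ->]]]] //.
case: (nth _ _ _) Hits => w q [a o jz jn]; rewrite !mem_cat => /or3P[] /=.
- by rewrite !inE => /or4P[] /eqP ->.
- by case/mapP => j _ ->.
- by case: o; rewrite !inE; do ?[case/orP]; move/eqP => ->.
Qed.

Lemma base_edges_src : all (fun e => (rsrc e).1 < 2) (base_edges prog n).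
Proof.
apply/allP => e; rewrite !mem_cat => /or3P[/mapP[i _ ->]||/mapP[i _ ->]] //.
by rewrite !inE => /or3P[] /eqP ->.
Qed.

Lemma edges_public : public_edges (edges prog n).
Proof.
apply/allP => e; rewrite mem_cat => /orP[].
  rewrite !mem_cat => /or3P[/mapP[i _ ->]|| /mapP[i _ ->]] //.
  by rewrite !inE => /or3P[] /eqP ->.
case/pats_edgesP => i [j [lti ltj]].
have start : (nth pat0 (patterns prog) i).1 != lfin.
  have : nth pat0 (patterns prog) i \in patterns prog by apply: mem_nth.
  by case/patternsP => [[d _ ->]|->|[k [its [_ _ ->]]]].
have srcn : item_src (nth pat0 (patterns prog) i) i j != lfin by case: (j).
rewrite !mem_cat => /or3P[]; last case: eqP => // _; rewrite ?inE.
- by move/eqP => ->; rewrite srcn.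
- by case/mapP => h _ ->.
- by case/orP => [/eqP ->|/mapP[h _ ->]] //; rewrite srcn.
Qed.

Definition when_ok (k : nat) (w : when) : bool :=
  match w with Always => true | Before => k < n | After => n <= k end.

Lemma cfg_rule k : ~~ (size prog < (cfg n prog k).1) ->
  exists i, [/\ i < size (rules prog), rstate (nth rule0 (rules prog) i) = (cfg n prog k).1,
    when_ok k (rwhen (nth rule0 (rules prog) i)) &
    cfg n prog k.+1 = istep (rinstr (nth rule0 (rules prog) i)) (cfg n prog k).2].
Proof.
rewrite -leqNgt /= /mstep; case: (cfg n prog k) => -[|q] s /= leq_p.
  case: ltnP => ltkn; first by exists 0.
  by exists 1.
exists q.+2; rewrite /= size_map size_iota !ltnS leq_p (nth_map 0) ?size_iota //.
by rewrite nth_iota.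
Qed.

(** At a given step at most one rule fits the state, so a rule guessed by the automaton with the
    right state and time is the true step. *)
Lemma rule_cfg k i : i < size (rules prog) ->
  rstate (nth rule0 (rules prog) i) = (cfg n prog k).1 ->
  when_ok k (rwhen (nth rule0 (rules prog) i)) ->
  ~~ (size prog < (cfg n prog k).1) /\
  cfg n prog k.+1 = istep (rinstr (nth rule0 (rules prog) i)) (cfg n prog k).2.
Proof.
rewrite /= /mstep; case: (cfg n prog k) => q s /=.
case: i => [|[|i]] /=.
- by move=> _ <- ->.
- by move=> _ <- lenk; rewrite [k < n]ltnNge lenk.
rewrite size_map size_iota !ltnS => lti; rewrite (nth_map 0) ?size_iota // nth_iota //=.
by move=> <- _; rewrite lti -leqNgt.
Qed.

Lemma cfg_state_lt k : (cfg n prog k).1 < nstates prog.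
Proof.
elim: k => [|k IH] //.
case: (boolP (size prog < (cfg n prog k).1)) => [|/cfg_rule[i [lti _ _ ->]]].
  by rewrite /= /mstep; case: (cfg n prog k) IH => -[|q] s //= ltq; rewrite ltnS [q < size _]ltnNge => ->.
by have [_ ? ? _] := rule_bounds lti; rewrite /istep /=; case: ifP.
Qed.

End Bounds.

Section Real.
Local Open Scope ring_scope.
Variables (R : realType) (n : nat) (prog : seq instr).

Local Notation N := (period prog).
Local Notation G := (grid prog).
Local Notation cfg := (cfg n prog).

Lemma satr_atom (rho : resets R) t c k d g :
  satr rho t (atom c k d :: g) = sat_cmp k (t - rho c) d%:R && satr rho t g.
Proof. by rewrite /satr /sat /= ffunE. Qed.

Lemma satr_nil (rho : resets R) t : satr rho t [::]. Proof. by []. Qed.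

Lemma in_unitE (rho : resets R) t d : satr rho t (in_unit d) = (d%:R <= t - rho cz < d%:R + 1).
Proof. by rewrite !satr_atom satr_nil andbT /= -natr1. Qed.

Lemma neq_guardsE (rho : resets R) t c d :
  sat_some (neq_guards c d) rho t = (t != rho c + d%:R).
Proof.
by rewrite /sat_some /= !satr_atom !satr_nil !andbT orbF /= -neq_lt subr_eq addrC.
Qed.

Definition pstart (k : nat) : R := (k * N)%:R.

Lemma pstart0 : pstart 0 = 0. Proof. by []. Qed.

Lemma pstartS k : pstart k.+1 = pstart k + N%:R.
Proof. by rewrite /pstart mulSn addnC natrD. Qed.

(** The offset [q.+1] is strictly inside a period, so comparing the date with [n] periods amounts to
    comparing [k] with [n]. *)
Lemma when_guardE (rho : resets R) t k q w : (q < nstates prog)%N ->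
  t - rho cw = pstart k + q.+1%:R -> satr rho t (when_guard prog n w) = when_ok n k w.
Proof.
move=> ltq Et; case: w => //=; rewrite satr_atom satr_nil andbT /= Et /pstart -natrD.
  rewrite ltr_nat /period /grid; case: ltnP => H; case: ltnP => H' //; nia.
rewrite ler_nat /period /grid; case: leqP => H; case: leqP => H' //; nia.
Qed.

End Real.

(** * Words without violations *)

Lemma phase_edge_in prog n e : e \in phase_edges prog -> e \in edges prog n.
Proof. by move=> eE; rewrite !mem_cat eE !orbT. Qed.

Lemma rule_edge_in prog n i : i < size (rules prog) ->
  rule_edge prog n i (nth rule0 (rules prog) i) \in edges prog n.
Proof.
by move=> lti; rewrite !mem_cat (map_f (fun i => rule_edge prog n i _)) // mem_iota.
Qed.

Lemma rule_loop_in prog n i : i < size (rules prog) ->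
  (lrule i, [::], set0, lrule i) \in edges prog n.
Proof.
move=> lti; rewrite !mem_cat (_ : _ \in rule_loops prog) ?orbT //.
by apply: (map_f (fun i => (lrule i, [::], set0, lrule i) : redge)); rewrite mem_iota.
Qed.

Lemma rule_pattern_in prog i its : i < size (rules prog) ->
  its \in rule_violations prog (nth rule0 (rules prog) i) -> (lrule i, its) \in patterns prog.
Proof.
move=> lti Hits; rewrite 2!mem_cat (_ : _ \in rule_patterns prog) ?orbT //.
apply/flatten_mapP; exists i; first by rewrite mem_iota.
exact: map_f.
Qed.

Lemma sorted_le_last (R : realType) (t e : R) (b : seq R) :
  sorted <=%R (t :: b) -> e \in t :: b -> (e <= last t b)%R.
Proof.
elim: b t e => [|t' b IH] t e; first by rewrite inE => _ /eqP ->.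
rewrite /= inE => /andP[let' Hs] /predU1P[->|eb]; last exact: IH.
by apply: le_trans let' (IH _ _ Hs _); rewrite inE eqxx.
Qed.

Ltac linear_arith := repeat match goal with
  | H : is_true (_ \in _) |- _ => clear H
  | H : is_true (leq _ _) |- _ => clear H
  | H : is_true (sorted _ _) |- _ => clear H
  | H : @eq nat _ _ |- _ => clear H
  | H : tail_of _ _ _ |- _ => clear H
  | H : matches _ _ _ _ |- _ => clear H
  | H : forall _, _ |- _ => clear H
  end; lra.

Section Soundness.
Local Open Scope ring_scope.
Variables (R : realType) (n : nat) (prog : seq instr).

Local Notation N := (period prog).
Local Notation G := (grid prog).
Local Notation M := (marker prog).
Local Notation cfg := (cfg n prog).
Local Notation E := (edges prog n).
Local Notation pstart := (@pstart R prog).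

Hypothesis nonhalting : forall k, ~~ (size prog < (cfg k).1)%N.

Variables (t0 : R) (ts' : seq R).
Let ts := t0 :: ts'.
Hypothesis ts_sorted : sorted <=%R ts.
Hypothesis rejected : ~ acc E ts l0 (fun=> 0).

Definition rho_phase k : resets R := fun c => if c == cz then t0 + pstart k else t0.

Definition rho_rule k (q : nat) : resets R := fun c =>
  if c == cz then t0 + pstart k else if c == cx then t0 + pstart k + q.+1%:R else t0.

Lemma updr_all (rho : resets R) t : updr rho setT t = fun=> t.
Proof. by apply/funext => c; rewrite /updr inE. Qed.

(** A public run may reset [cz] at each of these anchors and loop elsewhere; were the remaining tail
    accepted, so would be the whole word. *)
Lemma phase_rejected k : (forall m, (m <= k)%N -> t0 + pstart m \in ts) ->
  exists2 b, tail_of ts (t0 + pstart k) b & ~ acc E b lphase (rho_phase k).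
Proof.
elim: k => [|k IH] anchors.
  exists ts' => [|Hacc].
    by rewrite pstart0 addr0; exact: (@tail_of_cat _ [::]).
  apply: rejected; exists (l0, [::], setT, lphase); split=> //.
    by apply: phase_edge_in; rewrite !inE eqxx.
  right; rewrite /= updr_all; congr (acc _ _ _ _): Hacc; apply/funext => c.
  by rewrite /rho_phase pstart0 addr0 if_same.
have [|b Hb Hacc] := IH; first by move=> m lem; apply: anchors; exact: leqW.
have N0 : 0 < N%:R :> R by rewrite ltr0n.
have lt_a : t0 + pstart k < t0 + pstart k.+1 by rewrite pstartS; lra.
have [sb _ inb _] := Hb.
have ab := inb _ (anchors _ (leqnn _)) lt_a.
have [a [b' [Eb _ Hb']]] := split_first sb ab.
exists b'; first exact: tail_of_trans (ltW lt_a) Hb Hb'.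
move=> Hacc'; apply: Hacc; rewrite Eb; apply: acc_skip.
  by apply: phase_edge_in; rewrite !inE eqxx orbT.
exists (lphase, [:: atom cz CEq N], [set cz], lphase); split=> //.
- by apply: phase_edge_in; rewrite !inE eqxx !orbT.
- by rewrite satr_atom satr_nil /= /rho_phase /= pstartS; apply/andP; split=> //; apply/eqP; ring.
right; congr (acc _ _ _ _): Hacc'; apply/funext => c.
by rewrite /rho_phase /updr inE; case: eqP.
Qed.

Lemma init_event d : (0 < d)%N ->
  d \in [:: 1%N, G & [seq M j | j <- iota 0 (nregs prog)]] -> t0 + d%:R \in ts.
Proof.
move=> d0 Hd; apply/negPn/negP => notin; apply: rejected.
pose it : item := ([::], setT, neq_guards cw d).
apply: (@pattern_acc_first _ _ _ (l0, [:: it]) it [::]) => //.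
  rewrite 2!mem_cat; apply/orP; left.
  exact: (map_f (fun d => (l0, [:: ([::], setT, neq_guards cw d)]) : pattern)).
apply/allP => s sts; rewrite neq_guardsE updr_all.
by apply: contraNneq notin => <-; rewrite inE sts orbT.
Qed.

Lemma rule_rejected k i : (forall m, (m <= k)%N -> t0 + pstart m \in ts) ->
  (i < size (rules prog))%N -> rstate (nth rule0 (rules prog) i) = (cfg k).1 ->
  when_ok n k (rwhen (nth rule0 (rules prog) i)) ->
  t0 + pstart k + (cfg k).1.+1%:R \in ts ->
  exists2 b, tail_of ts (t0 + pstart k + (cfg k).1.+1%:R) b &
    forall its, its \in rule_violations prog (nth rule0 (rules prog) i) ->
    ~ matches its any_guard (rho_rule k (cfg k).1) b.
Proof.
move=> anchors lti Eq Hw; set q := (cfg k).1; set sg := _ + _ => sin.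
have [b Hb Hacc] := phase_rejected anchors.
have lt_sg : t0 + pstart k < sg by rewrite ltrDl ltr0n.
have [sb _ inb _] := Hb.
have [a [b' [Eb _ Hb']]] := split_first sb (inb _ sin lt_sg).
exists b'; first exact: tail_of_trans (ltW lt_sg) Hb Hb'.
move=> its Hits Hm; apply: Hacc; rewrite Eb; apply: acc_skip.
  by apply: phase_edge_in; rewrite !inE eqxx orbT.
exists (rule_edge prog n i (nth rule0 (rules prog) i)); split=> //.
- exact: rule_edge_in.
- rewrite /= satr_atom Eq /= /rho_phase /= -/q (@when_guardE _ _ _ _ _ k q).
  + by rewrite Hw andbT; apply/eqP; rewrite /sg; ring.
  + exact: cfg_state_lt.
  + by rewrite /rho_phase /= /sg; ring.
right; rewrite /=.
have -> : updr (rho_phase k) [set cx] sg = rho_rule k q.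
  by apply/funext => c; rewrite /updr inE /rho_rule /rho_phase; case: eqP => [->|].
apply: (@pattern_acc R (base_edges prog n) (patterns prog) (lrule i, its)) => //.
- exact: rule_pattern_in.
- exact: patterns_nonempty (rule_pattern_in lti Hits).
- exact: rule_loop_in.
Qed.

Lemma forced_event (g : constr 4) r c d (rho : resets R) b t : sorted <=%R b ->
  ~ matches [:: (g, r, neq_guards c d)] any_guard rho b ->
  t \in b -> satr rho t g -> updr rho r t c + d%:R \in b.
Proof.
move=> sb Hm tb Ht; apply/negPn/negP => notin; apply: Hm.
apply: (matches_intro sb tb) => // b' [_ subb _ _].
apply/allP => s /subb sin; rewrite neq_guardsE.
by apply: contraNneq notin => <-.
Qed.

Lemma updr1 (rho : resets R) c t c' : updr rho [set c] t c' = if c' == c then t else rho c'.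
Proof. by rewrite /updr inE. Qed.

Lemma next_grid_intro Z sg u v g its (rho : resets R) b : rho cz = Z ->
  tail_of ts sg b -> sg < u -> G%:R <= u - Z < G%:R + 1 -> u \in ts -> v \in ts -> u < v ->
  (forall s, s \in ts -> u < s -> v <= s) ->
  satr (updr rho [set cx] u) v g ->
  (forall b', tail_of ts v b' ->
     matches its any_guard (updr (updr rho [set cx] u) [set cy] v) b') ->
  matches (next_grid prog g its) any_guard rho b.
Proof.
move=> EZ Hb ltsg Hu uts vts ltuv next Hg Hits; have [sb _ inb _] := Hb.
apply: (matches_intro sb (inb _ uts ltsg)) => // [|b1 Hb1]; first by rewrite in_unitE EZ.
have {}Hb1 := tail_of_trans (ltW ltsg) Hb Hb1; have [sb1 sub1 inb1 leb1] := Hb1.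
apply: (matches_intro sb1 (inb1 _ vts ltuv)) => [s s1 ltsv||b2 Hb2].
- rewrite /sat_some /= satr_atom satr_nil /= updr1 /= andbT orbF subr_eq0.
  rewrite eq_le leb1 // andbT leNgt; apply/negP => /next; rewrite (sub1 _ s1) => /(_ isT).
  by rewrite leNgt ltsv.
- by rewrite satr_atom Hg andbT /= updr1 /= subr_gt0.
by apply: Hits; exact: tail_of_trans (ltW ltuv) Hb1 Hb2.
Qed.

(** The grid found in the first period, to which all later ones are compared. Repeated dates are
    merged so that a rank determines a point. *)
Definition grid_points : seq R :=
  sort <=%R (undup [seq s <- [seq s - t0 - G%:R | s <- ts] | 0 <= s < 1]).

Local Notation gp := grid_points.

Lemma mem_grid_points f : (f \in gp) = (0 <= f < 1) && (t0 + G%:R + f \in ts).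
Proof.
rewrite mem_sort mem_undup mem_filter; congr (_ && _).
apply/mapP/idP => [[s sts ->]|H].
  by rewrite (_ : _ + _ = s) //; ring.
by exists (t0 + G%:R + f) => //; ring.
Qed.

Lemma grid_points_sorted : sorted <%R gp.
Proof. by rewrite sort_lt_sorted undup_uniq. Qed.

Lemma grid_pointP i : (i < size gp)%N -> 0 <= gp`_i < 1.
Proof. by move=> lti; have := mem_nth 0 lti; rewrite mem_grid_points => /andP[]. Qed.

Lemma grid_point0 : (0 < size gp)%N /\ gp`_0 = 0.
Proof.
have in0 : 0 \in gp.
  by rewrite mem_grid_points lexx ltr01 addr0 init_event // !inE eqxx orbT.
have sz : (0 < size gp)%N by case: gp in0.
split=> //; apply/eqP; rewrite eq_le; have /andP[-> _] := grid_pointP sz.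
have := @lt_sorted_ltn_nth _ _ 0 _ grid_points_sorted (index 0 gp) 0.
by rewrite !inE index_mem nth_index // andbT leNgt => ->.
Qed.

Lemma seq_extremum (le : rel R) (P : pred R) (s : seq R) x :
  total le -> transitive le -> x \in s -> P x ->
  exists y, [/\ y \in s, P y & forall z, z \in s -> P z -> le y z].
Proof.
move=> tot tr xs Px.
have memE z : z \in sort le (filter P s) = P z && (z \in s) by rewrite mem_sort mem_filter.
have := sort_sorted tot (filter P s); move: (memE x); rewrite Px xs /=.
case: (sort le _) memE => [|y l] memE //= _ Hl; exists y.
have := memE y; rewrite inE eqxx /= => /esym/andP[Py ys]; split=> // z zs Pz.
have := memE z; rewrite Pz zs inE /= => /predU1P[->|].
  by have := tot y y; rewrite orbb.
exact/allP/(order_path_min tr Hl).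
Qed.

Definition grid_copy k := forall f, 0 <= f < 1 ->
  (t0 + pstart k + G%:R + f \in ts) = (f \in gp).

(** Were [f] new, the greatest grid point [u] below it and the first event [v] after [u] in period
    [k] would frame it: [v] at or before [f] would be a grid point contradicting the choice of [u].
    The event [e] provides [v] and places it before the next period. *)
Lemma grid_backward k e f : (forall m, (m <= k)%N -> t0 + pstart m \in ts) ->
  grid_copy k -> e \in ts -> t0 + pstart k + G%:R + 1 <= e < t0 + pstart k.+1 ->
  0 <= f < 1 -> t0 + pstart k.+1 + G%:R + f \in ts -> f \in gp.
Proof.
move=> anchors copy ets /andP[lee lte] f01 fts; apply/negPn/negP => fgp.
have [b Hb Hacc] := phase_rejected anchors; apply: Hacc.
have [sz gp0] := grid_point0.
have in0 : 0 \in gp by rewrite -gp0 mem_nth.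
set Z := t0 + pstart k in copy lee Hb *.
have G0 : 0 < G%:R :> R by rewrite ltr0n.
have /andP[f0 f1] := f01.
have [||u [ugp leuf umax]] := @seq_extremum >=%R (fun x => x <= f) gp 0 _ _ in0 f0.
- by move=> x y; exact: le_total.
- by move=> x y z /=; move=> h1 h2; exact: le_trans h2 h1.
have u01 : 0 <= u < 1 by move: ugp; rewrite mem_grid_points => /andP[].
have ltuf : u < f by rewrite lt_neqAle leuf andbT; apply: contraNneq fgp => <-.
have uts : Z + G%:R + u \in ts by rewrite copy.
have ltue : Z + G%:R + u < e by lra.
have [||v [vts ltuv vmin]] := @seq_extremum <=%R (fun x => Z + G%:R + u < x) ts e _ _ ets ltue.
- exact: le_total.
- exact: le_trans.
have leve : v <= e by exact: vmin.
have ltfv : Z + G%:R + f < v.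
  rewrite ltNge; apply/negP => levf.
  have v01 : 0 <= v - Z - G%:R < 1 by lra.
  have : v - Z - G%:R \in gp by rewrite -copy // (_ : Z + G%:R + (v - Z - G%:R) = v) //; ring.
  move/umax => /= H; have : v - Z - G%:R <= u by apply: H; lra.
  by lra.
apply: (@pattern_acc R (base_edges prog n) (patterns prog) (new_grid_point prog)) => //.
- by rewrite 2!mem_cat mem_seq1 eqxx orbT.
- by apply: phase_edge_in; rewrite !inE eqxx orbT.
apply: (@next_grid_intro Z Z (Z + G%:R + u) v _ _ _ _ _ Hb) => //; [lra|lra|].
move=> b' Hb'; have [sb' sub' inb' leb'] := Hb'.
rewrite pstartS in fts lte; rewrite -/Z in fts.
have Ef : t0 + (pstart k + N%:R) + G%:R + f = Z + N%:R + G%:R + f by rewrite /Z; ring.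
rewrite Ef in fts; rewrite addrA -/Z in lte.
have ltv : v < Z + N%:R + G%:R + f by lra.
apply: (matches_intro sb' (inb' _ fts ltv)) => // [|b2 _]; last by apply/allP.
by rewrite /= !satr_atom satr_nil !updr1 /= /rho_phase /= -/Z natrD -[G.+1%:R]natr1; lra.
Qed.

Lemma markerE j : (M j)%:R = G%:R + 1 + j%:R :> R.
Proof. by rewrite /marker natrD -[G.+1%:R]natr1. Qed.

Lemma periodE : N%:R = G%:R + 1 + (nregs prog)%:R :> R.
Proof. by rewrite /period natrD -[G.+1%:R]natr1. Qed.

(** Register values are ranks in the grid, so the grid has to be exact; for anchors, states and
    markers, presence is enough. *)
Definition simulates k :=
  [/\ forall m, (m <= k)%N -> t0 + pstart m \in ts,
      t0 + pstart k + (cfg k).1.+1%:R \in ts,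
      grid_copy k &
      forall j, (j < nregs prog)%N -> ((cfg k).2 j < size gp)%N /\
        t0 + pstart k + (M j)%:R + gp`_((cfg k).2 j) \in ts].

Lemma simulates0 : simulates 0.
Proof.
have [sz gp0] := grid_point0; split.
- by move=> m; rewrite leqn0 => /eqP ->; rewrite pstart0 addr0 inE eqxx.
- by rewrite pstart0 addr0 init_event // inE eqxx.
- by move=> f f01; rewrite pstart0 addr0 mem_grid_points f01.
move=> j ltj; split=> //; rewrite pstart0 addr0 gp0 addr0 init_event //.
by rewrite 2!in_cons (map_f M) ?orbT // mem_iota.
Qed.

Lemma grid_point_after f c : (c < size gp)%N -> f \in gp -> gp`_c < f ->
  exists2 i, (c < i < size gp)%N & f = gp`_i.
Proof.
move=> ltc /(nthP 0)[i lti <-]; rewrite lt_sorted_ltn_nth ?grid_points_sorted ?inE //.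
by move=> ltci; exists i; rewrite ?ltci.
Qed.

Lemma grid_next k c : grid_copy k -> (c.+1 < size gp)%N -> forall e, e \in ts ->
  t0 + pstart k + G%:R + gp`_c < e -> t0 + pstart k + G%:R + gp`_c.+1 <= e.
Proof.
set Z := t0 + _ => copy ltc e ets lte; rewrite leNgt; apply/negP => gte.
have H0 := grid_pointP (ltnW ltc); have H1 := grid_pointP ltc.
have e01 : 0 <= e - Z - G%:R < 1 by lra.
have egp : e - Z - G%:R \in gp by rewrite -copy // (_ : Z + _ + _ = e) //; ring.
have [||i /andP[ltci lti] Ei] := @grid_point_after _ c _ egp; [exact: ltnW|lra|].
have : gp`_i < gp`_c.+1 by lra.
by rewrite lt_sorted_ltn_nth ?grid_points_sorted ?inE // ltnS leqNgt ltci.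
Qed.

Lemma simulatesS k : simulates k -> simulates k.+1.
Proof.
case=> anchors state copy markers.
have [i [lti Eq Hw Ecfg]] := cfg_rule (nonhalting k).
have [b Hb viol] := rule_rejected anchors lti Eq Hw state.
have := rule_bounds lti.
case Er: (nth rule0 (rules prog) i) Eq Ecfg viol {Hw lti} => [w q [a o jz jn]] /= Eq.
rewrite [mstep _ _ _ _](_ : _ = cfg k.+1) //.
set s := (cfg k).2 in markers *; rewrite -Eq in state Hb * => Ecfg viol [ltq ltjz ltjn lta].
set Z := t0 + pstart k in copy markers state Hb.
have [sb subb inb leb] := Hb.
have ltqG : q.+1%:R < G%:R :> R by rewrite ltr_nat.
have late e : e \in ts -> Z + G%:R <= e -> e \in b by move=> ets lee; apply: inb => //; linear_arith.
(* A violation with a single item becomes an existence statement: if its trigger is in the word, so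
   is its consequence. *)
have force g r c d t : [:: (g, r, neq_guards c d)] \in
      rule_violations prog (Rule w q (Instr a o jz jn)) ->
    t \in ts -> Z + G%:R <= t -> satr (rho_rule k q) t g ->
    updr (rho_rule k q) r t c + d%:R \in ts.
  move=> Hv tts let_ Hg; apply: subb; apply: forced_event (viol _ Hv) _ Hg => //.
  exact: late.
have first4 v : v \in take 4 (rule_violations prog (Rule w q (Instr a o jz jn))) ->
    v \in rule_violations prog (Rule w q (Instr a o jz jn)) by exact: mem_take.
have [sz gp0] := grid_point0.
have EZ : t0 + pstart k.+1 = Z + N%:R by rewrite pstartS addrA.
have G0 : 0 < G%:R :> R by rewrite ltr0n.
have gin : Z + G%:R \in ts.
  by have := copy 0; rewrite lexx ltr01 addr0 => ->//; rewrite -gp0 mem_nth.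
have rz : rho_rule k q cz = Z by [].
have rx : rho_rule k q cx = Z + q.+1%:R by [].
have mk j : (j < nregs prog)%N -> [/\ Z + (M j)%:R + gp`_(s j) \in ts, 0 <= gp`_(s j) < 1,
    Z + G%:R <= Z + (M j)%:R + gp`_(s j) & G%:R + 1 <= (M j)%:R :> R].
  move=> ltj; have [lts mts] := markers _ ltj; have H01 := grid_pointP lts.
  have j0 : 0 <= j%:R :> R by rewrite ler0n.
  by have mE := markerE j; split=> //; linear_arith.
have anchors' m : (m <= k.+1)%N -> t0 + pstart m \in ts.
  rewrite leq_eqVlt => /predU1P[->|]; last by rewrite ltnS; apply: anchors.
  (* The trigger is the first grid point; the delay is counted from the state event, at offset
     [q.+1]. *)
  rewrite EZ (_ : _ + _ = updr (rho_rule k q) set0 (Z + G%:R) cx + (N - q.+1)%:R).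
    apply: (force [:: atom cz CEq G]) => //; last first.
      by rewrite satr_atom rz /= addrAC subrr add0r eqxx.
    by apply: first4; rewrite /= !inE eqxx ?orbT.
  rewrite updr0 rx natrB; first by ring.
  by rewrite /period /grid; lia.
have jump j : (j < nstates prog)%N ->
    t0 + pstart k.+1 + j.+1%:R = rho_rule k q cx + (N + j - q)%:R.
  move=> ltj; rewrite rx EZ natrB ?natrD -?[q.+1%:R]natr1 -?[j.+1%:R]natr1; first by ring.
  by rewrite /period /grid; lia.
have [ain a01 aG Ga] := mk _ lta; have [ltsa _] := markers _ lta.
(* This makes the zero test visible: the grid increases strictly from 0, so only value 0 has
   fractional part 0. *)
have gpa : (gp`_(s a) == 0) = (s a == 0%N).
  apply/eqP/eqP => [E0|->//]; have := @lt_sorted_ltn_nth _ _ 0 _ grid_points_sorted 0 (s a).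
  by rewrite !inE => /(_ sz ltsa); rewrite gp0 E0 ltxx lt0n => /esym/negbFE/eqP.
split=> //.
- rewrite Ecfg /istep /=; case: eqP => sa.
    rewrite jump // -(updr0 (rho_rule k q) (Z + (M a)%:R)).
    apply: (force [:: atom cz CEq (M a)]).
    + by apply: first4; rewrite /= !inE eqxx ?orbT.
    + by move: ain; rewrite sa gp0 addr0.
    + by linear_arith.
    + by rewrite satr_atom rz /= addrAC subrr add0r eqxx.
  rewrite jump // -(updr0 (rho_rule k q) (Z + (M a)%:R + gp`_(s a))).
  apply: (force [:: atom cz CGt (M a); atom cz CLt (M a).+1]) => //.
    by apply: first4; rewrite /= !inE eqxx ?orbT.
  have : gp`_(s a) != 0 by rewrite gpa; apply/eqP.
  rewrite !satr_atom rz -[(M a).+1%:R]natr1 /= satr_nil => gpn0.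
  have : 0 < gp`_(s a) by rewrite lt_neqAle eq_sym gpn0; case/andP: a01.
  by linear_arith.
- move=> f f01; apply/idP/idP.
    (* The marker of [a] serves as the event beyond the grid and within the period. *)
    apply: (grid_backward anchors copy ain _ f01); rewrite EZ -/Z periodE markerE.
    have : a%:R + 1 <= (nregs prog)%:R :> R by rewrite natr1 ler_nat.
    have : 0 <= a%:R :> R by rewrite ler0n.
    by linear_arith.
  move=> fgp; rewrite EZ (_ : _ + f = updr (rho_rule k q) [set cx] (Z + G%:R + f) cx + N%:R);
    last by rewrite updr1 /=; ring.
  apply: (force (in_unit G)).
  + by apply: first4; rewrite /= !inE eqxx ?orbT.
  + by rewrite copy.
  + by linear_arith.
  + by rewrite in_unitE rz; linear_arith.
have unchanged j : (j < nregs prog)%N ->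
    marker_unchanged prog j \in rule_violations prog (Rule w q (Instr a o jz jn)) ->
    t0 + pstart k.+1 + (M j)%:R + gp`_(s j) \in ts.
  move=> ltj Hv; have [jin j01 jG _] := mk _ ltj.
  rewrite EZ (_ : _ + _ = updr (rho_rule k q) [set cx] (Z + (M j)%:R + gp`_(s j)) cx + N%:R);
    last by rewrite updr1 /=; ring.
  by apply: (force _ _ _ _ _ Hv) => //; rewrite in_unitE rz; linear_arith.
move=> j ltj; rewrite Ecfg /istep /= /upd; case: eqP => [->|/eqP ja]; last first.
  have [lts _] := markers _ ltj; split=> //; apply: unchanged => //.
  rewrite 2!mem_cat; apply/orP; right; apply/orP; left; apply: map_f.
  by rewrite mem_filter ja mem_iota.
have last_op v : v \in match o with
    | OpNop => [:: marker_unchanged prog a]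
    | OpInc => [:: next_grid prog [:: atom cz CLt G.+1]
          [:: ([:: atom cx CEq a.+1], set0, neq_guards cy (N + a.+1))];
        [:: (in_unit G, [set cx], [:: [:: atom cx CEq 0]; [:: atom cz CGe G.+1]]);
            ([:: atom cx CEq a.+1], set0, any_guard)]]
    | OpDec => [:: [:: ([:: atom cz CEq (M a)], [set cx], neq_guards cx N)];
        next_grid prog [:: atom cz CLt G.+1]
          [:: ([:: atom cy CEq a.+1], set0, neq_guards cx (N + a.+1))]]
    end -> v \in rule_violations prog (Rule w q (Instr a o jz jn)).
  by move=> Hv; rewrite 2!mem_cat Hv !orbT.
have a0 : 0 <= a%:R :> R by rewrite ler0n.
have EG1 : G.+1%:R = G%:R + 1 :> R by rewrite -[G.+1%:R]natr1.
have Ea1 : a.+1%:R = a%:R + 1 :> R by rewrite -[a.+1%:R]natr1.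
have EMa := markerE a.
have ltsg : Z + q.+1%:R < Z + G%:R by linear_arith.
case: o force first4 unchanged last_op viol Ecfg {Er} => force _ unchanged last_op viol _ /=.
- by split=> //; apply: unchanged => //; apply: last_op; rewrite inE.
(* At the last grid point the forbidden increment pattern would match: only copies of that point and
   events beyond the grid precede the marker. *)
- case: (ltnP (s a).+1 (size gp)) => lts; last first.
    exfalso; apply: (viol [:: (in_unit G, [set cx], [:: [:: atom cx CEq 0]; [:: atom cz CGe G.+1]]);
            ([:: atom cx CEq a.+1], set0, any_guard)]); first by apply: last_op; rewrite !inE eqxx orbT.
    have uts : Z + G%:R + gp`_(s a) \in ts by rewrite copy // mem_nth.
    have ub : Z + G%:R + gp`_(s a) \in b by apply: late => //; linear_arith.
    apply: (matches_intro sb ub) => // [|b1 [sb1 sub1 inb1 leb1]].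
      by rewrite in_unitE rz; linear_arith.
    have ab1 : Z + (M a)%:R + gp`_(s a) \in b1.
      by apply: inb1; [apply: late|linear_arith].
    apply: (matches_intro sb1 ab1) => [e eb1 lte||b2 _]; last by apply/allP.
      rewrite /sat_some /= !satr_atom !satr_nil !andbT orbF !updr1 /= rz subr_eq0 EG1.
      case: eqP => //= /eqP neu; rewrite leNgt; apply/negP => lteG.
      have leu := leb1 _ eb1.
      have {}leu : Z + G%:R + gp`_(s a) < e by rewrite lt_neqAle eq_sym neu.
      have egp : e - Z - G%:R \in gp.
        rewrite -copy; last by linear_arith.
        by rewrite (_ : Z + _ + _ = e) ?(subb _ (sub1 _ eb1)) //; ring.
      have [|c] := grid_point_after ltsa egp; first by linear_arith.
      by move=> /andP[ltsc ltcs] _; move: (leq_trans ltcs lts); rewrite ltnS leqNgt ltsc.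
    by rewrite satr_atom satr_nil andbT /= updr1 /= Ea1; apply/eqP; rewrite EMa; ring.
  split=> //; apply/negPn/negP => notin.
  have H1 := grid_pointP lts.
  have ltgp : gp`_(s a) < gp`_(s a).+1 by rewrite lt_sorted_ltn_nth ?grid_points_sorted ?inE.
  apply: (viol (next_grid prog [:: atom cz CLt G.+1]
          [:: ([:: atom cx CEq a.+1], set0, neq_guards cy (N + a.+1))])).
    by apply: last_op; rewrite inE eqxx.
  (* The marker is [a.+1] after the point of rank [s a]; the missing one would be [N + a.+1] after
     the next point. *)
  apply: (@next_grid_intro Z (Z + q.+1%:R) (Z + G%:R + gp`_(s a)) (Z + G%:R + gp`_(s a).+1) _ _ _ _ rz Hb).
  + by linear_arith.
  + by linear_arith.
  + by rewrite copy // mem_nth.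
  + by rewrite copy // mem_nth.
  + by linear_arith.
  + exact: grid_next.
  + by rewrite satr_atom satr_nil andbT updr1 /= rz EG1; linear_arith.
  move=> b' [sb' sub' inb' leb'].
  have ab' : Z + (M a)%:R + gp`_(s a) \in b' by apply: inb' => //; linear_arith.
  apply: (matches_intro sb' ab') => // [|b2 [_ sub2 _ _]].
    by rewrite satr_atom satr_nil andbT !updr1 /= Ea1; apply/eqP; rewrite EMa; ring.
  apply/allP => e /sub2/sub' ein; rewrite neq_guardsE updr0 !updr1 /=.
  apply: contraNneq notin => Ee; rewrite (_ : _ + _ = e) //.
  by rewrite Ee EZ natrD EMa Ea1; ring.
(* Value 0 has no lower neighbour in the grid; a separate pattern keeps its marker in place. *)
- case Esa: (s a) => [|c] /=.
    split=> //; rewrite EZ gp0 addr0.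
    rewrite (_ : _ + _ = updr (rho_rule k q) [set cx] (Z + (M a)%:R) cx + N%:R);
      last by rewrite updr1 /=; ring.
    apply: (force [:: atom cz CEq (M a)]).
    + by apply: last_op; rewrite inE eqxx.
    + by move: ain; rewrite Esa gp0 addr0.
    + by linear_arith.
    + by rewrite satr_atom rz /= addrAC subrr add0r eqxx.
  have ltc : (c.+1 < size gp)%N by rewrite -Esa.
  split; first exact: ltnW.
  apply/negPn/negP => notin.
  have H0 := grid_pointP (ltnW ltc).
  rewrite Esa in ain a01 aG.
  have ltgp : gp`_c < gp`_c.+1 by rewrite lt_sorted_ltn_nth ?grid_points_sorted ?inE // ltnW.
  apply: (viol (next_grid prog [:: atom cz CLt G.+1]
          [:: ([:: atom cy CEq a.+1], set0, neq_guards cx (N + a.+1))])).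
    by apply: last_op; rewrite !inE eqxx orbT.
  (* The marker now belongs to the upper point, and the missing one to the lower point. *)
  apply: (@next_grid_intro Z (Z + q.+1%:R) (Z + G%:R + gp`_c) (Z + G%:R + gp`_c.+1) _ _ _ _ rz Hb).
  + by linear_arith.
  + by linear_arith.
  + by rewrite copy // mem_nth // ltnW.
  + by rewrite copy // mem_nth.
  + by linear_arith.
  + exact: grid_next.
  + by rewrite satr_atom satr_nil andbT updr1 /= rz EG1; linear_arith.
  move=> b' [sb' sub' inb' leb'].
  have ab' : Z + (M a)%:R + gp`_c.+1 \in b' by apply: inb' => //; linear_arith.
  apply: (matches_intro sb' ab') => // [|b2 [_ sub2 _ _]].
    by rewrite satr_atom satr_nil andbT !updr1 /= Ea1; apply/eqP; rewrite EMa; ring.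
  apply/allP => e /sub2/sub' ein; rewrite neq_guardsE updr0 !updr1 /=.
  apply: contraNneq notin => Ee; rewrite (_ : _ + _ = e) //.
  by rewrite Ee EZ natrD EMa Ea1; ring.
Qed.

(** A period has length at least 1, so the anchor of period [k] places the last event at least [k]
    after the first one, for every [k]. *)
Lemma simulation_absurd : False.
Proof.
have sim k : simulates k by elim: k => [|k]; [exact: simulates0|exact: simulatesS].
have bnd k : k%:R <= last t0 ts' - t0.
  have [/(_ k (leqnn k)) kin _ _ _] := sim k.
  have := sorted_le_last ts_sorted kin.
  have : k%:R <= pstart k by rewrite /pstart ler_nat leq_pmulr.
  by linear_arith.
have := bnd (Num.bound (last t0 ts' - t0)); rewrite leNgt.
have [d0|d0] := leP 0 (last t0 ts' - t0); first by rewrite archi_boundP.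
by have := bnd 0%N; rewrite leNgt d0.
Qed.

End Soundness.

(** * The word of a halting run *)

Section Completeness.
Local Open Scope ring_scope.
Variables (R : realType) (n : nat) (prog : seq instr).

Local Notation N := (period prog).
Local Notation G := (grid prog).
Local Notation M := (marker prog).
Local Notation cfg := (cfg n prog).
Local Notation E := (edges prog n).
Local Notation pstart := (@pstart R prog).

Variables K top : nat.
Hypothesis halted : (size prog < (cfg K).1)%N.
Hypothesis regs_le : forall k j, (k <= K)%N -> (j < nregs prog)%N -> ((cfg k).2 j <= top)%N.

(** As [top] bounds the registers up to step [K], a grid of [top.+1] equally spaced points leaves
    room for every increment. *)
Definition frac (i : nat) : R := i%:R / top.+1%:R.

Lemma frac0 : frac 0 = 0. Proof. by rewrite /frac mul0r. Qed.

Lemma lt_frac i j : (frac i < frac j) = (i < j)%N.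
Proof. by rewrite /frac ltr_pM2r ?ltr_nat // invr_gt0 ltr0n. Qed.

Lemma frac_inj : injective frac.
Proof.
move=> i j E0; apply/eqP; rewrite eqn_leq leqNgt -lt_frac E0 ltxx /=.
by rewrite leqNgt -lt_frac E0 ltxx.
Qed.

Lemma frac01 i : (i <= top)%N -> 0 <= frac i < 1.
Proof.
move=> lei; rewrite /frac divr_ge0 ?ler0n //=.
by rewrite ltr_pdivrMr ?ltr0n // mul1r ltr_nat ltnS.
Qed.

Definition offsets (k : nat) : seq R :=
  [:: 0; (cfg k).1.+1%:R] ++ [seq G%:R + frac i | i <- iota 0 top.+1] ++
  [seq (M j)%:R + frac ((cfg k).2 j) | j <- iota 0 (nregs prog)].

Definition word : seq R :=
  sort <=%R (flatten [seq [seq pstart k + o | o <- offsets k] | k <- iota 0 K.+1]).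

Lemma word_sorted : sorted <=%R word.
Proof. by apply: sort_sorted; exact: le_total. Qed.

Lemma wordP t : reflect (exists k o, [/\ (k <= K)%N, o \in offsets k & t = pstart k + o])
  (t \in word).
Proof.
rewrite mem_sort; apply: (iffP flatten_mapP) => [[k]|[k [o [lek Ho Et]]]].
  by rewrite mem_iota add0n => /andP[_ ltk] /mapP[o Ho ->]; exists k, o.
by exists k; [rewrite mem_iota|rewrite Et; apply: map_f].
Qed.

Lemma offsetsP k o : o \in offsets k ->
  [\/ o = 0, o = (cfg k).1.+1%:R, exists2 i, (i <= top)%N & o = G%:R + frac i |
      exists2 j, (j < nregs prog)%N & o = (M j)%:R + frac ((cfg k).2 j)].
Proof.
rewrite 2!mem_cat mem_seq2 => /or3P[/orP[]/eqP ->|/mapP[i]|/mapP[j]].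
- by constructor 1.
- by constructor 2.
- by rewrite mem_iota add0n => /andP[_ lti] ->; constructor 3; exists i.
- by rewrite mem_iota add0n => /andP[_ ltj] ->; constructor 4; exists j.
Qed.

Lemma state_offset k : 0 <= (cfg k).1%:R :> R /\ (cfg k).1.+1%:R + 1 <= G%:R :> R.
Proof.
by rewrite ler0n; split=> //; rewrite natr1 ler_nat /grid ltnS cfg_state_lt.
Qed.

Lemma marker_offset j : (j < nregs prog)%N ->
  0 <= j%:R :> R /\ j%:R + 1 <= (nregs prog)%:R :> R.
Proof. by move=> ltj; rewrite ler0n natr1 ler_nat. Qed.

Lemma offsets_bounds k o : (k <= K)%N -> o \in offsets k -> 0 <= o < N%:R.
Proof.
move=> lek; have G0 : 0 < G%:R :> R by rewrite ltr0n.
have EN := periodE R prog; have n1 : 1 <= (nregs prog)%:R :> R by rewrite ler1n.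
case/offsetsP => [->|->|[i lei ->]|[j ltj ->]].
- by lra.
- by have [? ?] := state_offset k; rewrite ler0n /=; lra.
- by have := frac01 lei; lra.
have := frac01 (regs_le lek ltj); have := markerE R prog j; have [] := marker_offset ltj.
by lra.
Qed.

Lemma period_inj k k' (o o' : R) : 0 <= o < N%:R -> 0 <= o' < N%:R ->
  pstart k + o = pstart k' + o' -> k = k' /\ o = o'.
Proof.
move=> Ho Ho' E0.
have lt_absurd i j : (i < j)%N -> pstart i + N%:R <= pstart j.
  by move=> ltij; rewrite -pstartS ler_nat leq_mul2r ltij orbT.
case: (ltngtP k k') => [/lt_absurd|/lt_absurd|Ek]; [lra|lra|].
by split=> //; rewrite Ek in E0; lra.
Qed.

Lemma word_offset t m : t \in word -> 0 <= t - pstart m < N%:R ->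
  (m <= K)%N /\ t - pstart m \in offsets m.
Proof.
case/wordP => k [o [lek Ho ->]] H.
have [|E1 E2] := @period_inj k m _ _ (offsets_bounds lek Ho) H; first by ring.
by rewrite -E2 -E1.
Qed.

Lemma offset_state k q : (k <= K)%N -> (q < nstates prog)%N -> q.+1%:R \in offsets k ->
  q = (cfg k).1.
Proof.
move=> lek ltq; have ltG : q.+1%:R < G%:R :> R by rewrite ltr_nat /grid.
have q0 : 0 < q.+1%:R :> R by rewrite ltr0n.
case/offsetsP => [E0|/eqP|[i lei]|[j ltj]].
- by exfalso; lra.
- by rewrite eqr_nat eqSS => /eqP.
- by have := frac01 lei; move=> ? ?; exfalso; lra.
have := frac01 (regs_le lek ltj); have := markerE R prog j; have [] := marker_offset ltj.
by move=> *; exfalso; lra.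
Qed.

Lemma offset_grid k o : (k <= K)%N -> o \in offsets k -> G%:R <= o < G%:R + 1 ->
  exists2 i, (i <= top)%N & o = G%:R + frac i.
Proof.
move=> lek; have G0 : 0 < G%:R :> R by rewrite ltr0n.
case/offsetsP => [->|->|//|[j ltj]].
- by lra.
- by have [? ?] := state_offset k; lra.
have := frac01 (regs_le lek ltj); have := markerE R prog j; have [] := marker_offset ltj.
by lra.
Qed.

Lemma offset_marker k o j : (k <= K)%N -> o \in offsets k -> (M j)%:R <= o < (M j)%:R + 1 ->
  o = (M j)%:R + frac ((cfg k).2 j).
Proof.
move=> lek; have G0 : 0 < G%:R :> R by rewrite ltr0n.
have EM := markerE R prog; have j0 : 0 <= j%:R :> R by rewrite ler0n.
case/offsetsP => [->|->|[i lei ->]|[j' ltj' ->]].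
- by rewrite EM; lra.
- by have [? ?] := state_offset k; rewrite EM; lra.
- by have := frac01 lei; rewrite EM; lra.
have := frac01 (regs_le lek ltj'); rewrite !EM => f01 H.
case: (ltngtP j j') => [|| -> //]; rewrite -[(_ < _)%N](ler_nat R) -natr1; lra.
Qed.

Lemma anchor_in k : (k <= K)%N -> pstart k \in word.
Proof. by move=> lek; apply/wordP; exists k, 0; rewrite addr0 inE eqxx. Qed.

Lemma state_in k : (k <= K)%N -> pstart k + (cfg k).1.+1%:R \in word.
Proof. by move=> lek; apply/wordP; exists k, (cfg k).1.+1%:R; rewrite !inE eqxx orbT. Qed.

Lemma grid_in k i : (k <= K)%N -> (i <= top)%N -> pstart k + (G%:R + frac i) \in word.
Proof.
move=> lek lei; apply/wordP; exists k, (G%:R + frac i); split=> //.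
rewrite 2!mem_cat; apply/orP; right; apply/orP; left.
by apply: (map_f (fun i => G%:R + frac i)); rewrite mem_iota.
Qed.

Lemma marker_in k j : (k <= K)%N -> (j < nregs prog)%N ->
  pstart k + ((M j)%:R + frac ((cfg k).2 j)) \in word.
Proof.
move=> lek ltj; apply/wordP; exists k, ((M j)%:R + frac ((cfg k).2 j)); split=> //.
rewrite 2!mem_cat; apply/orP; right; apply/orP; right.
by apply: (map_f (fun j => (M j)%:R + frac ((cfg k).2 j))); rewrite mem_iota.
Qed.

Lemma matches_missing g r c d (rho : resets R) b : sorted <=%R b ->
  matches [:: (g, r, neq_guards c d)] any_guard rho b ->
  exists2 t, t \in b /\ satr rho t g &
    forall e, e \in b -> t < e -> e <> updr rho r t c + d%:R.
Proof.
move=> sb /(matches_elim sb)[t [b' [tb _ Hg [_ _ inb' _] Hm]]].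
exists t => // e eb lte; apply/eqP; rewrite -neq_guardsE.
exact: (allP Hm) (inb' _ eb lte).
Qed.

Lemma next_grid_elim g its (rho : resets R) b m sg : rho cz = pstart m ->
  tail_of word sg b -> matches (next_grid prog g its) any_guard rho b ->
  exists i v b', [/\ (m <= K)%N /\ (i <= top)%N, v \in word,
    pstart m + (G%:R + frac i) < v,
    forall e, e \in word -> pstart m + (G%:R + frac i) < e -> v <= e &
    [/\ satr (updr rho [set cx] (pstart m + (G%:R + frac i))) v g, tail_of word v b' &
    matches its any_guard (updr (updr rho [set cx] (pstart m + (G%:R + frac i))) [set cy] v) b']].
Proof.
move=> rz Hb; have [sb subb inb leb] := Hb.
move=> /(matches_elim sb)[u [b1 [ub _ Hu Hb1 Hm]]].
have {}Hb1 := tail_of_trans (leb _ ub) Hb Hb1; have [sb1 sub1 inb1 leb1] := Hb1.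
move: Hu; rewrite in_unitE rz => Hu.
have EN := periodE R prog; have G0 : 0 < G%:R :> R by rewrite ltr0n.
have n1 : 1 <= (nregs prog)%:R :> R by rewrite ler1n.
have [|lem Ho] := word_offset (m := m) (subb _ ub); first by linear_arith.
have [i lei Ei] := offset_grid lem Ho Hu.
have Eu : u = pstart m + (G%:R + frac i) by rewrite -Ei; ring.
move: Hm => /(matches_elim sb1)[v [b2 [vb1 loops Hv Hb2 Hm]]].
move: Hv; rewrite satr_atom updr1 /= subr_gt0 => /andP[ltuv Hg].
exists i, v, b2; rewrite -Eu; split=> //; first exact: sub1.
  move=> e eword lte; rewrite leNgt; apply/negP => /(loops e (inb1 _ eword lte)).
  by rewrite /sat_some /= satr_atom satr_nil /= updr1 /= andbT orbF; linear_arith.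
by split=> //; exact: tail_of_trans (ltW ltuv) Hb1 Hb2.
Qed.

(** All grids of the word are translates of each other, so the third event comes from a grid point
    strictly between two consecutive events. *)
Lemma new_grid_point_absurd (rho : resets R) b m sg : rho cz = pstart m ->
  tail_of word sg b -> ~ matches (new_grid_point prog).2 any_guard rho b.
Proof.
move=> rz Hb /(next_grid_elim rz Hb)[i [v [b' [[lem lei] vw ltuv next [_ Hb' Hm]]]]].
have [sb' sub' _ _] := Hb'.
move: Hm => /(matches_elim sb')[t [b2 [tb' _ Ht _ _]]].
move: Ht; rewrite !satr_atom satr_nil !updr1 /= rz natrD -[G.+1%:R]natr1 => Ht.
have EN := periodE R prog; have G0 : 0 < G%:R :> R by rewrite ltr0n.
have n1 : 1 <= (nregs prog)%:R :> R by rewrite ler1n.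
have i01 := frac01 lei; have EP := pstartS R prog m.
have [|lem1 Ho] := word_offset (m := m.+1) (sub' _ tb'); first by linear_arith.
have [|j lej Ej] := offset_grid lem1 Ho; first by linear_arith.
have := next _ (grid_in lem lej); linear_arith.
Qed.

(** The offset of the event that fires the rule determines the state and the guard on [cw] the
    loading phase, so the rule is the true step [m]. The consequences it asks for are then events of
    period [m.+1]. *)
Lemma violation_absurd i m (rho : resets R) b its : (i < size (rules prog))%N ->
  rho cz = pstart m -> rho cw = 0 -> rho cx \in word ->
  rho cx = pstart m + (rstate (nth rule0 (rules prog) i)).+1%:R ->
  satr rho (rho cx) (when_guard prog n (rwhen (nth rule0 (rules prog) i))) ->
  tail_of word (rho cx) b -> its \in rule_violations prog (nth rule0 (rules prog) i) ->
  ~ matches its any_guard rho b.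
Proof.
move=> lti rz rw xw Ex Hw Hb; have [ltq ltjz ltjn lta] := rule_bounds lti.
have ltqG : (rstate (nth rule0 (rules prog) i)).+1%:R < G%:R :> R by rewrite ltr_nat.
have EN := periodE R prog; have G0 : 0 < G%:R :> R by rewrite ltr0n.
have n1 : 1 <= (nregs prog)%:R :> R by rewrite ler1n.
have q0 : 0 < (rstate (nth rule0 (rules prog) i)).+1%:R :> R by rewrite ltr0n.
have [|lem Ho] := word_offset (m := m) xw; first by linear_arith.
have Eq : rstate (nth rule0 (rules prog) i) = (cfg m).1.
  by apply: offset_state lem ltq _; move: Ho; rewrite Ex addrAC subrr add0r.
rewrite (@when_guardE _ _ _ _ _ m _ _ ltq) in Hw; last by rewrite rw subr0.
have [nh Ecfg] := rule_cfg lti Eq Hw.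
(* No rule applies once the machine has halted, so the last period, which has no successor, triggers
   nothing. *)
have ltmK : (m < K)%N.
  by rewrite ltnNge; apply/negP => leKm; rewrite (cfg_halted halted leKm) in nh.
move: Eq Ecfg Ex ltq ltjz ltjn lta q0 ltqG.
case: (nth rule0 (rules prog) i) {lti Hw} => w q [a o jz jn].
rewrite [rstate _]/= [rinstr _]/= [ijz _]/= [ijn _]/= [ireg _]/=.
move=> Eq Ecfg Ex ltq ltjz ltjn lta q0 ltqG.
have [sb subb inb leb] := Hb.
have EP := pstartS R prog m; have EM := markerE R prog.
have ltqN j : (q <= N + j)%N by rewrite /period /grid; lia.
have ltqN' : (q.+1 <= N)%N by rewrite /period /grid; lia.
(* The trigger precedes the start of period [m.+1] and the consequence does not, so the latter is
   strictly later and remains in the tail. *)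
have missing g r c d : matches [:: (g, r, neq_guards c d)] any_guard rho b ->
    (forall t, t \in word -> satr rho t g -> rho cx <= t ->
      t < pstart m.+1 /\ updr rho r t c + d%:R \in word /\ pstart m.+1 <= updr rho r t c + d%:R) ->
    False.
  move=> /(matches_missing sb)[t [tb Ht] Hmiss] H.
  have [lt1 [inw le1]] := H _ (subb _ tb) Ht (leb _ tb).
  have lte := lt_le_trans lt1 le1.
  by apply: (Hmiss _ (inb _ inw _) lte) => //; have := leb _ tb; linear_arith.
have marker_at t j : t \in word -> (j < nregs prog)%N -> (M j)%:R <= t - pstart m < (M j)%:R + 1 ->
    t = pstart m + ((M j)%:R + frac ((cfg m).2 j)) /\ t < pstart m.+1.
  move=> tw ltj Ht; have [? ?] := marker_offset ltj; have EMj := EM j.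
  have [|_ {}Ho] := word_offset (m := m) tw; first by linear_arith.
  have := offset_marker lem Ho Ht; have := frac01 (regs_le lem ltj).
  by split; linear_arith.
have fa := frac01 (regs_le lem lta); have EMa := EM a; have [a0 an] := marker_offset lta.
have unchanged j : (j < nregs prog)%N -> (cfg m.+1).2 j = (cfg m).2 j ->
    ~ matches (marker_unchanged prog j) any_guard rho b.
  move=> ltj Ej /missing; apply=> t tw; rewrite in_unitE rz => Ht _.
  have [Et ltt] := marker_at _ _ tw ltj Ht; split=> //; rewrite updr1 /=.
  have := marker_in ltmK ltj; rewrite Ej EP (_ : _ + _ = t + N%:R); last by rewrite Et; ring.
  by move=> ->; split=> //; have := EM j; have [? ?] := marker_offset ltj;
    have := frac01 (regs_le lem ltj); linear_arith.
have E1 : (cfg m.+1).1 = if (cfg m).2 a == 0%N then jz else jn by rewrite Ecfg.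
have E2 : (cfg m.+1).2 = upd (cfg m).2 a (apply_op o ((cfg m).2 a)) by rewrite Ecfg.
have jump j : (cfg m.+1).1 = j -> rho cx + (N + j - q)%:R \in word /\
    pstart m.+1 <= rho cx + (N + j - q)%:R.
  move=> Ej; rewrite natrB // natrD Ex; have := state_in ltmK; rewrite Ej.
  rewrite (_ : _ + (_ - _) = pstart m.+1 + j.+1%:R) => [->|].
    by rewrite lerDl ler0n.
  by rewrite EP -[j.+1%:R]natr1 -[q.+1%:R]natr1; ring.
have Ea1 : a.+1%:R = a%:R + 1 :> R by rewrite -[a.+1%:R]natr1.
(* Consecutive events within the grid are neighbouring grid points. *)
have grid_succ its' : matches (next_grid prog [:: atom cz CLt G.+1] its') any_guard rho b ->
    exists j b', [/\ tail_of word (pstart m + (G%:R + frac j.+1)) b', (j.+1 <= top)%N &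
      matches its' any_guard (updr (updr rho [set cx] (pstart m + (G%:R + frac j)))
        [set cy] (pstart m + (G%:R + frac j.+1))) b'].
  move=> /(next_grid_elim rz Hb)[j [v [b' [[_ lej] vw ltuv next [Hv Hb' Hm]]]]].
  move: Hv; rewrite satr_atom satr_nil andbT updr1 /= rz -[G.+1%:R]natr1 => Hv.
  have j01 := frac01 lej.
  have [|_ {}Ho] := word_offset (m := m) vw; first by linear_arith.
  have [|j' lej' Ej'] := offset_grid lem Ho; first by linear_arith.
  have ltjj' : (j < j')%N by rewrite -lt_frac; linear_arith.
  have lej1 : (j.+1 <= top)%N := leq_trans ltjj' lej'.
  have ltj : frac j < frac j.+1 by rewrite lt_frac.
  have Ejj : j' = j.+1.
    apply/eqP; rewrite eqn_leq ltjj' andbT leqNgt -lt_frac.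
    by have := next _ (grid_in lem lej1); linear_arith.
  have Ev : v = pstart m + (G%:R + frac j.+1) by rewrite -Ejj -Ej'; ring.
  by exists j, b'; rewrite -Ev.
rewrite /rule_violations 2!mem_cat => /or3P[|/mapP[j]|].
- rewrite mem_seq4 => /or4P[] /eqP -> /missing; apply=> t tw.
  + rewrite satr_atom satr_nil andbT /= rz => /eqP Ht _.
    have [|Et ltt] := marker_at _ _ tw lta; first by linear_arith.
    split=> //; rewrite updr0; apply: jump; rewrite E1.
    have -> : (cfg m).2 a = 0%N by apply: frac_inj; rewrite frac0; linear_arith.
    by [].
  + rewrite !satr_atom satr_nil andbT /= rz -[(M a).+1%:R]natr1 => Ht _.
    have [|Et ltt] := marker_at _ _ tw lta; first by linear_arith.
    split=> //; rewrite updr0; apply: jump; rewrite E1.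
    by case: eqP => // E0; exfalso; rewrite E0 frac0 in Et; linear_arith.
  + rewrite satr_atom satr_nil andbT /= rz => /eqP Ht _.
    split; first by linear_arith.
    rewrite updr0 natrB // Ex.
    rewrite (_ : _ + (_ - _) = pstart m.+1); last by rewrite EP; ring.
    by rewrite lexx anchor_in.
  + rewrite in_unitE rz => Ht _; split; first by linear_arith.
    have [|_ {}Ho] := word_offset (m := m) tw; first by linear_arith.
    have [j lej Ej] := offset_grid lem Ho Ht.
    have Et : t = pstart m + (G%:R + frac j) by rewrite -Ej; ring.
    rewrite updr1 /= Et (_ : _ + _ = pstart m.+1 + (G%:R + frac j)); last by rewrite EP; ring.
    by split; [exact: grid_in|have := frac01 lej; linear_arith].
- rewrite mem_filter mem_iota => /andP[ja /andP[_ ltj]] ->; apply: unchanged => //.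
  by rewrite E2 /upd (negPf ja).
case: o E2 {Ecfg} => /= E2.
- rewrite mem_seq1 => /eqP ->; apply: unchanged => //.
  by rewrite E2 /upd eqxx.
- have Ea : (cfg m.+1).2 a = ((cfg m).2 a).+1 by rewrite E2 /upd eqxx.
  have le1 : (((cfg m).2 a).+1 <= top)%N by rewrite -Ea; exact: regs_le.
  have fa1 := frac01 le1.
  rewrite mem_seq2 => /orP[] /eqP ->.
    move=> /grid_succ[j [b' [Hb' lej Hm]]]; have [sb' sub' inb' leb'] := Hb'.
    have [t [tb']] := matches_missing sb' Hm.
    rewrite satr_atom satr_nil andbT !updr1 /= Ea1 => /eqP Ht.
    have j01 := frac01 (ltnW lej); have j01' := frac01 lej.
    have [|Et ltt] := marker_at _ _ (sub' _ tb') lta; first by linear_arith.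
    have Esa : (cfg m).2 a = j by apply: frac_inj; linear_arith.
    rewrite updr0 !updr1 /= natrD Ea1 => Hmiss.
    have := marker_in ltmK lta; rewrite Ea Esa EP => ein.
    apply: (Hmiss _ (inb' _ ein _)); linear_arith.
  move=> /(matches_elim sb)[u [b1 [ub _ Hu Hb1 Hm]]].
  have {}Hb1 := tail_of_trans (leb _ ub) Hb Hb1; have [sb1 sub1 inb1 leb1] := Hb1.
  move: Hu; rewrite in_unitE rz => Hu.
  have [|_ {}Ho] := word_offset (m := m) (subb _ ub); first by linear_arith.
  have [j lej Ej] := offset_grid lem Ho Hu; have j01 := frac01 lej.
  move: Hm => /(matches_elim sb1)[t [b2 [tb1 loops Ht _ _]]].
  move: Ht; rewrite satr_atom satr_nil andbT updr1 /= Ea1 => /eqP Ht.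
  have [|Et ltt] := marker_at _ _ (sub1 _ tb1) lta; first by linear_arith.
  have Esa : (cfg m).2 a = j by apply: frac_inj; linear_arith.
  (* The incremented value is at most [top], so its grid point occurs before the marker. It
     satisfies neither loop guard: [cx] is positive there and the grid is not over. *)
  rewrite Esa in le1 fa1; have gin := grid_in lem le1.
  have ltj : frac j < frac j.+1 by rewrite lt_frac.
  have : sat_some [:: [:: atom cx CEq 0]; [:: atom cz CGe G.+1]] (updr rho [set cx] u)
      (pstart m + (G%:R + frac j.+1)).
    by apply: loops; [apply: inb1 => //|]; linear_arith.
  rewrite /sat_some /= !satr_atom !satr_nil !andbT orbF !updr1 /= rz -[G.+1%:R]natr1.
  by case/orP => [/eqP|]; linear_arith.
- have Ea : (cfg m.+1).2 a = ((cfg m).2 a).-1 by rewrite E2 /upd eqxx.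
  rewrite mem_seq2 => /orP[] /eqP ->.
    move=> /missing; apply=> t tw; rewrite satr_atom satr_nil andbT /= rz => /eqP Ht _.
    have [|Et ltt] := marker_at _ _ tw lta; first by linear_arith.
    have Esa : (cfg m).2 a = 0%N by apply: frac_inj; rewrite frac0; linear_arith.
    have := marker_in ltmK lta; rewrite Ea Esa frac0 updr1 /=.
    rewrite (_ : pstart m.+1 + _ = t + N%:R); last by linear_arith.
    by move=> ->; do 2!split=> //; linear_arith.
  move=> /grid_succ[j [b' [Hb' lej Hm]]]; have [sb' sub' inb' leb'] := Hb'.
  have [t [tb']] := matches_missing sb' Hm.
  rewrite satr_atom satr_nil andbT !updr1 /= Ea1 => /eqP Ht.
  have j01 := frac01 (ltnW lej); have j01' := frac01 lej.
  have [|Et ltt] := marker_at _ _ (sub' _ tb') lta; first by linear_arith.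
  have Esa : (cfg m).2 a = j.+1 by apply: frac_inj; linear_arith.
  rewrite updr0 !updr1 /= natrD Ea1 => Hmiss.
  have := marker_in ltmK lta; rewrite Ea Esa EP /= => ein.
  apply: (Hmiss _ (inb' _ ein _)); linear_arith.
Qed.

End Completeness.

(** * The automaton rejects the word of a halting run *)

Section Rejection.
Local Open Scope ring_scope.
Variables (R : realType) (n : nat) (prog : seq instr).

Local Notation N := (period prog).
Local Notation G := (grid prog).
Local Notation M := (marker prog).
Local Notation cfg := (cfg n prog).
Local Notation E := (edges prog n).
Local Notation pstart := (@pstart R prog).

Variables K top : nat.
Hypothesis halted : (size prog < (cfg K).1)%N.
Hypothesis regs_le : forall k j, (k <= K)%N -> (j < nregs prog)%N -> ((cfg k).2 j <= top)%N.

Local Notation word := (@word R n prog K top).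

Lemma base_edgesP e : e \in base_edges prog n ->
  [\/ exists2 i, (i < size (rules prog))%N & e = rule_edge prog n i (nth rule0 (rules prog) i),
      e = (l0, [::], setT, lphase),
      e = (lphase, [::], set0, lphase) \/ e = (lphase, [:: atom cz CEq N], [set cz], lphase) |
      exists i, e = (lrule i, [::], set0, lrule i)].
Proof.
rewrite 2!mem_cat mem_seq3 => /or3P[/mapP[i]|/or3P[] /eqP ->|/mapP[i _ ->]].
- by rewrite mem_iota add0n => /andP[_ lti] ->; constructor 1; exists i.
- by constructor 2.
- by constructor 3; left.
- by constructor 3; right.
- by constructor 4; exists i.
Qed.

Lemma acc_start_edges l t ts (rho : resets R) : (l.1 < 2)%N -> acc E (t :: ts) l rho ->
  (exists e, [/\ e \in base_edges prog n, rsrc e = l, satr rho t (rguard e) &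
      (rtgt e = lfin /\ ts = [::]) \/ acc E ts (rtgt e) (updr rho (rreset e) t)]) \/
  exists2 p, p \in patterns prog /\ p.1 = l &
    exists it its, [/\ p.2 = it :: its, satr rho t it.1.1 &
      matches its it.2 (updr rho it.1.2 t) ts].
Proof.
move=> ltl /(acc_start (base_edges_src n prog) (patterns_src prog) (edges_public n prog) ltl).
by case=> [|[p [it [its [? ? ? ? ?]]]]]; [left|right; exists p => //; exists it, its].
Qed.

Lemma tail_of_cons (ts : seq R) sg t b : tail_of ts sg (t :: b) ->
  sg <= t /\ tail_of ts t b.
Proof.
move=> Htl; have [sb _ _ leb] := Htl.
have let_ : sg <= t by apply: leb; rewrite inE eqxx.
by split=> //; apply: tail_of_trans let_ Htl (@tail_of_cat _ [::] _ _ sb).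
Qed.

Lemma acc_rule_matches i (rho : resets R) b : acc E b (lrule i) rho ->
  exists2 its, its \in rule_violations prog (nth rule0 (rules prog) i) &
    matches its any_guard rho b.
Proof.
elim: b => [|t b IH] //.
case/acc_start_edges => [//|[e [eB Esrc Hg Hacc]]|[p [pin Ep1] [it [its [Ep2 Ht Hm]]]]].
  case/base_edgesP: eB Esrc Hg Hacc => [[j _ ->]|->|[]->|[j ->]] // [->] _ [[]//|].
  rewrite updr0 => /IH[[|it its] Hits Hm].
    by exists [::] => //; rewrite /= Hm.
  by exists (it :: its) => //; case: Hm => a [t' [b' [-> ? ? ?]]]; exists (t :: a), t', b'.
case/patternsP: pin Ep1 Ep2 => [[d _ ->]|->|[j [its' [ltj Hits' ->]]]] // [Ej] Ep2.
exists (it :: its); first by rewrite -Ep2 -Ej.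
by exists [::], t, b.
Qed.

(** Whatever the choices in [lphase], [cz] is reset only when it equals the period, hence at a
    multiple of it, and [cw] is never reset. *)
Lemma acc_phase_absurd m (rho : resets R) sg b :
  rho cz = pstart m -> rho cw = 0 -> tail_of word sg b -> ~ acc E b lphase rho.
Proof.
elim: b m rho sg => [|t b IH] m rho sg rz rw Hb //.
have [let_ Hb'] := tail_of_cons Hb.
have tw : t \in word by case: Hb => _ subb _ _; apply: subb; rewrite inE eqxx.
case/acc_start_edges => [//|[e [eB Esrc Hg Hacc]]|[p [pin Ep1] [it [its [Ep2 Ht Hm]]]]].
  case/base_edgesP: eB Esrc Hg Hacc => [[i lti ->]|->|[]->|[j ->]] // _.
  - rewrite satr_atom rz /= => /andP[/eqP Ez Hw] [[]//|/acc_rule_matches[its Hits]].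
    set rho' := updr rho [set cx] t.
    have x' : rho' cx = t by rewrite /rho' updr1.
    have z' : rho' cz = pstart m by rewrite /rho' updr1.
    have w' : rho' cw = 0 by rewrite /rho' updr1.
    apply: (violation_absurd halted regs_le lti z' w'); rewrite ?x' //.
    + by rewrite -Ez; ring.
    + by case: (rwhen _) Hw => //=; rewrite !satr_atom w' rw.
  - by move=> _ [[]//|]; rewrite updr0; apply: IH rz rw Hb'.
  - rewrite satr_atom satr_nil andbT /= rz => /eqP Hz [[]//|].
    apply: (IH m.+1 _ t) => //; rewrite updr1 //= pstartS -Hz; ring.
case/patternsP: pin Ep1 Ep2 => [[d _ ->]|->|[j [its' [ltj Hits' ->]]]] // _ Ep2.
apply: (new_grid_point_absurd regs_le rz Hb).
by rewrite Ep2; exists [::], t, b.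
Qed.

Lemma word_rejected : ~ acc E word l0 (fun=> 0).
Proof.
have EG : 0 < G%:R :> R by rewrite ltr0n.
have w0 : 0 \in word by have := anchor_in R n prog top (leq0n K); rewrite pstart0.
have pos t : t \in word -> 0 <= t.
  case/wordP => k [o [lek Ho ->]]; have /andP[? _] := offsets_bounds regs_le lek Ho.
  by rewrite addr_ge0 // ler0n.
have sw := word_sorted R n prog K top.
case Ew: word => [|t b] //; have t0 : t = 0.
  apply/eqP; rewrite eq_le pos ?Ew ?inE ?eqxx // andbT.
  move: sw w0; rewrite Ew => /= sw; rewrite inE => /predU1P[->//|].
  exact: (allP (order_path_min le_trans sw)).
have Htl : tail_of word 0 b by move: sw; rewrite Ew t0; apply: (@tail_of_cat _ [::]).
case/acc_start_edges => [//|[e [eB Esrc Hg Hacc]]|[p [pin Ep1] [it [its [Ep2 Ht Hm]]]]].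
  case/base_edgesP: eB Esrc Hg Hacc => [[i lti ->]|->|[]->|[j ->]] // _ _ [[]//|].
  by rewrite updr_all t0; apply: (@acc_phase_absurd 0 _ 0).
case/patternsP: pin Ep1 Ep2 => [[d Hd ->]|->|[j [its' [ltj Hits' ->]]]] // _ [Eit Eits].
move: Hm; rewrite -Eit -Eits /= updr_all t0 => /allP Hm.
suff [d0 dw] : (0 < d)%N /\ d%:R \in word.
  have [_ _ inb _] := Htl; have := Hm _ (inb _ dw _); rewrite ltr0n d0 neq_guardsE add0r eqxx.
  by move/(_ isT).
move: Hd; rewrite 2!in_cons => /or3P[/eqP ->|/eqP ->|/mapP[j]].
- by have := @state_in R n prog K top 0 (leq0n K); rewrite pstart0 add0r.
- by split=> //; have := @grid_in R n prog K top 0 0 (leq0n K) (leq0n top); rewrite pstart0 frac0 add0r addr0.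
rewrite mem_iota add0n => /andP[_ ltj] ->; split=> //.
by have := @marker_in R n prog K top 0 j (leq0n K) ltj; rewrite pstart0 frac0 add0r addr0.
Qed.

End Rejection.

Lemma universal_halts (R : realType) n prog :
  universal (edges prog n) R <-> ~ halts n prog.
Proof.
split=> [uni [K halted]|nh t ts Hs]; last first.
  apply: contrapT => rej; apply: (@simulation_absurd R n prog _ t ts _ rej).
    by move=> k; apply/negP => lt_k; apply: nh; exists k.
  exact: path_sorted Hs.
pose top := \max_(k < K.+1) \max_(j < nregs prog) (cfg n prog k).2 j.
have regs_le k j : k <= K -> j < nregs prog -> (cfg n prog k).2 j <= top.
  rewrite -ltnS => ltk ltj; apply: leq_trans (leq_bigmax (Ordinal ltk)).
  exact: (@leq_bigmax _ (fun j : 'I_(nregs prog) => (cfg n prog k).2 j) (Ordinal ltj)).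
apply: (@word_rejected R n prog K top halted regs_le).
have w0 := anchor_in R n prog top (leq0n K); have sw := word_sorted R n prog K top.
case Ew: (word _ _ _ _ _) w0 sw => [|t b] // _ sw; apply: uni.
rewrite /=; apply/andP; split=> //.
have : t \in word R n prog K top by rewrite Ew inE eqxx.
case/wordP => k [o [lek Ho ->]]; have /andP[? _] := offsets_bounds regs_le lek Ho.
by rewrite addr_ge0 // ler0n.
Qed.

(** * Codes of the automata and diagonalisation *)

(** The third entry is the code of the only action. *)
Definition enc_redge (e : redge) : nat :=
  CodeSeq.code [:: pickle (rsrc e); enc_constr (rguard e); 1; enc_set (rreset e);
                   pickle (rtgt e)].

Definition enc_loc_pair (b : nat) (l l' : loc) : nat :=
  enc_set ([set inord (pickle l); inord (pickle l')] : {set 'I_b.+1}).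

Lemma enc_ta_of E : enc_ta (ta_of E) =
  CodeSeq.code [:: 1; (rbound E).+1; 4; pickle l0;
    enc_loc_pair (rbound E) lpriv lprivf; enc_loc_pair (rbound E) lprivf lfin;
    CodeSeq.code (nseq (rbound E).+1 0);
    CodeSeq.code [seq enc_redge e | e <- E ++ priv_edges]].
Proof.
have Einv : [seq enc_constr (ta_inv (ta_of E) l) | l <- enum 'I_(rbound E).+1] =
    nseq (rbound E).+1 0.
  apply: (@eq_from_nth _ 0); first by rewrite size_map size_enum_ord size_nseq.
  move=> i; rewrite size_map => lti.
  by rewrite nth_nseq if_same (nth_map ord0) // /= ffunE.
have Eedges : [seq enc_edge e | e <- ta_edges (ta_of E)] =
    [seq enc_redge e | e <- E ++ priv_edges].
  rewrite -map_comp; apply/eq_in_map => e eE.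
  by rewrite /= /enc_edge /enc_redge /= !num_locE ?rlocs_src ?rlocs_tgt.
have El0 : num_loc E l0 = pickle l0 :> nat by rewrite num_locE.
rewrite /enc_ta /enc_seq Einv Eedges [ta_init _]/= El0 //.
Qed.

(** The two loading edges come first and no other edge mentions [n], so the rest may be taken at
    input 0. *)
Definition edges_tail (prog : seq instr) : seq redge := drop 2 (edges prog 0).

Lemma edgesE prog n : edges prog n =
  [:: rule_edge prog n 0 (Rule Before 0 (Instr 0 OpInc 0 0)),
      rule_edge prog n 1 (Rule After 0 (Instr 0 OpNop 1 1)) & edges_tail prog].
Proof.
rewrite /edges_tail /edges /base_edges /=; do 2!congr cons.
rewrite size_map size_iota drop0; congr ((_ ++ _) ++ _); apply/eq_in_map => i.
rewrite mem_iota => /andP[le2i lti]; case: i le2i lti => [|[|i]] // _ lti.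
by rewrite /= (nth_map 0) ?size_iota //; lia.
Qed.

Lemma rbound_edges prog n : rbound (edges prog n) = rbound (edges prog 0).
Proof. by rewrite /rbound /rlocs !edgesE. Qed.

Definition code_cons (x m : nat) : nat := 2 ^ x * m.*2.+1.

Lemma codeE x s : CodeSeq.code (x :: s) = code_cons x (CodeSeq.code s).
Proof. by []. Qed.

(** Here 3 is the number of the clock [cw], [C.*2] is the code of the integer [C], and 1 that of the
    action; only [C] varies with the input. *)
Definition load_edge_code (p p' a r k C : nat) : nat :=
  CodeSeq.code [:: p; CodeSeq.code [:: a; CodeSeq.code [:: 3; k; C.*2]]; 1; r; p'].

Definition load_edge (k : cmp) (i C : nat) : nat :=
  load_edge_code (pickle lphase) (pickle (lrule i)) (enc_atom (atom cz CEq 1))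
    (enc_set [set cx]) (enc_cmp k) C.

Definition instance_code (l b p f v e e1 e2 : nat) : nat :=
  code_cons 1 (code_cons b (code_cons 4 (code_cons l (code_cons p (code_cons f
    (code_cons v (code_cons (code_cons e1 (code_cons e2 e)) 0))))))).

Lemma enc_load_edge k i C :
  enc_redge (lphase, [:: atom cz CEq 1; atom cw k C], [set cx], lrule i) = load_edge k i C.
Proof. by []. Qed.

Lemma enc_instance prog : exists b p f v e N, forall n,
  enc_ta (ta_of (edges prog n)) = instance_code (pickle l0) b p f v e
    (load_edge CLt 0 (n * N)) (load_edge CGe 1 (n * N)).
Proof.
set B := rbound (edges prog 0).
exists B.+1, (enc_loc_pair B lpriv lprivf), (enc_loc_pair B lprivf lfin),
  (CodeSeq.code (nseq B.+1 0)),
  (CodeSeq.code [seq enc_redge e | e <- edges_tail prog ++ priv_edges]), (period prog) => n.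
have E1 := enc_load_edge CLt 0 (n * period prog).
have E2 := enc_load_edge CGe 1 (n * period prog).
by rewrite enc_ta_of rbound_edges -/B edgesE 2!cat_cons 2!map_cons !codeE -E1 -E2.
Qed.

Lemma computable_code_cons h h' : computable h -> computable h' ->
  computable (fun n => code_cons (h n) (h' n)).
Proof.
move=> ch ch'; apply: (computable2_comp computable2_mul (h1 := fun n => 2 ^ h n)).
  exact: computable_comp computable_pow2 ch.
apply: computable_succ; apply: computable_ext (computable2_comp computable2_add ch' ch').
by move=> n; rewrite addnn.
Qed.

Lemma computable_code_const c h : computable h -> computable (fun n => code_cons c (h n)).
Proof. exact: computable_code_cons (computable_const c). Qed.

Lemma computable_load_edge_code p p' a r k h : computable h ->
  computable (fun n => load_edge_code p p' a r k (h n)).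
Proof.
move=> ch.
have cdbl : computable (fun n => (h n).*2).
  apply: computable_ext (computable2_comp computable2_add ch ch).
  by move=> n; rewrite addnn.
change (computable (fun n => code_cons p (code_cons
    (code_cons a (code_cons (code_cons 3 (code_cons k (code_cons (h n).*2 0))) 0))
    (code_cons 1 (code_cons r (code_cons p' 0)))))).
apply: computable_code_const; apply: computable_code_cons (computable_const _).
apply: computable_code_const; apply: computable_code_cons _ (computable_const _).
do 2!apply: computable_code_const.
exact: computable_code_cons cdbl (computable_const _).
Qed.

Lemma computable_instance_code l hb hp hf hv he h1 h2 :
  computable hb -> computable hp -> computable hf -> computable hv -> computable he ->
  computable h1 -> computable h2 ->
  computable (fun n => instance_code l (hb n) (hp n) (hf n) (hv n) (he n) (h1 n) (h2 n)).
Proof.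
move=> cb cp cf cv ce c1 c2.
apply: computable_code_const; apply: computable_code_cons cb _.
do 2!apply: computable_code_const; apply: computable_code_cons cp _.
apply: computable_code_cons cf _; apply: computable_code_cons cv _.
apply: computable_code_cons _ (computable_const _).
exact: computable_code_cons c1 (computable_code_cons c2 ce).
Qed.

(* One computable function produces, from a suitable number, the code of the
   automaton that runs a given program on that very number. *)
Lemma diagonal_code : exists2 h, computable h &
  forall prog, exists c, h c = enc_ta (ta_of (edges prog c)).
Proof.
have [p1 [p2 [c1 c2 p1K p2K]]] := pair_decode.
have cit i : computable (fun c => p1 (iter i p2 c)).
  apply: (computable_comp c1); elim: i => [|i IH]; first exact: computable_id.
  exact: computable_comp c2 IH.
have cload k i : computable (fun c => load_edge k i (c * p1 (iter 5 p2 c))).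
  apply: computable_load_edge_code.
  exact: computable2_comp computable2_mul computable_id (cit 5).
exists (fun c => instance_code (pickle l0) (p1 (iter 0 p2 c)) (p1 (iter 1 p2 c))
  (p1 (iter 2 p2 c)) (p1 (iter 3 p2 c)) (p1 (iter 4 p2 c))
  (load_edge CLt 0 (c * p1 (iter 5 p2 c))) (load_edge CGe 1 (c * p1 (iter 5 p2 c)))).
  exact: computable_instance_code.
move=> prog; have [b [p [f [v [e [N EN]]]]]] := enc_instance prog.
(* [c] packs the six numbers that depend on the program and is also the input: [h] reads them off
   its argument and puts [c * N] in the two loading guards. *)
pose c := pair_code b (pair_code p (pair_code f (pair_code v (pair_code e (pair_code N 0))))).
exists c; rewrite {}EN.
have -> : p1 (iter 5 p2 c) = N by rewrite /= !(p1K, p2K).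
have -> : p1 (iter 4 p2 c) = e by rewrite /= !(p1K, p2K).
have -> : p1 (iter 3 p2 c) = v by rewrite /= !(p1K, p2K).
have -> : p1 (iter 2 p2 c) = f by rewrite /= !(p1K, p2K).
have -> : p1 (iter 1 p2 c) = p by rewrite /= !(p1K, p2K).
by have -> : p1 (iter 0 p2 c) = b by rewrite /= !(p1K, p2K).
Qed.

(** [D] is the decision procedure composed with [h]. On input [c] its program halts if the procedure
    answers 1 on the automaton of this very run, and loops if it answers 0, whereas [P] holds of
    that automaton exactly when the run does not halt. *)
Lemma undecidable_opacity (P : timed_automaton -> Prop) :
  (forall prog n, P (ta_of (edges prog n)) <-> ~ halts n prog) ->
  ~ decidable_on enc_ta (fun A => one_action A /\ no_epsilon A) P.
Proof.
move=> HP [f fP]; have [h ch hP] := diagonal_code.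
have [D DP] := computable_mueval_comp f ch.
have [c Ec] := hP (prog_of D).
have [] := fP (ta_of (edges (prog_of D) c)).
  by split; [exact: one_action_ta_of|exact: no_epsilon_ta_of].
rewrite -Ec => f1 f0.
have nP : ~ P (ta_of (edges (prog_of D) c)).
  by move=> PA; case/HP: (PA); apply: prog_of_halts; apply: DP; exact: f1.
by case: (nP); apply/HP; apply: prog_of_loops; apply: DP; exact: f0 nP.
Qed.

Theorem theorem5p2 (R : realType) :
  ~ decidable_on enc_ta (fun A => one_action A /\ no_epsilon A)
      (fun A => fully_opaque R A) /\
  ~ decidable_on enc_ta (fun A => one_action A /\ no_epsilon A)
      (fun A => weakly_opaque R A).
Proof.
split; apply: undecidable_opacity => prog n; rewrite -(universal_halts R).
  exact/fully_opaque_universal/edges_public.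
exact/weakly_opaque_universal/edges_public.
Qed.
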